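(* Let $U$ be a nonempty closed convex subset of $V$; let $\mathcal{B}:Q\to Q$ be a linear continuous operator for which there exists $m_{\mathcal B}>0$ with $(\mathcal{B}\boldsymbol\tau,\boldsymbol\tau)_Q\ge m_{\mathcal B}\|\boldsymbol\tau\|_Q^2$ for all $\boldsymbol\tau\in Q$; let $\mathcal{R}\in C([0,T];\mathbf{Q}_\infty)$; let $P:V\to V^*$ be a Lipschitz continuous monotone operator; and let $\boldsymbol f\in C([0,T];V^* )$. Let $\boldsymbol u\in C([0,T];U)$ be the unique common solution of Problems $\mathcal P$ and $\mathcal Q$ (see context). Then Problems $\mathcal P$ and $\mathcal Q$ are both $p$-well-posed and $q$-well-posed, that is: every $p$-approximating sequence converges to $\boldsymbol u$ in $C([0,T];V)$, and every $q$-approximating sequence converges to $\boldsymbol u$ in $C([0,T];V)$.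
   Context: Let $d\in\{1,2,3\}$, $\Omega\subset\mathbb R^d$ a bounded domain with smooth boundary $\Gamma$, $\Gamma_1\subset\Gamma$ a measurable part with positive $(d-1)$-dimensional measure, and $T>0$. Put $V=\{\boldsymbol v=(v_i)\in H^1(\Omega)^d: v_i=0\text{ on }\Gamma_1,\ i=1,\dots,d\}$ (in the sense of traces) and $Q=\{\boldsymbol\sigma=(\sigma_{ij}):\sigma_{ij}=\sigma_{ji}\in L^2(\Omega),\ i,j=1,\dots,d\}$. For $\boldsymbol v\in V$, $\boldsymbol\varepsilon(\boldsymbol v)=\frac12(\nabla\boldsymbol v+\nabla\boldsymbol v^T)\in Q$. $V$ and $Q$ are Hilbert spaces with inner products $(\boldsymbol u,\boldsymbol v)_V=\int_\Omega\boldsymbol\varepsilon(\boldsymbol u)\cdot\boldsymbol\varepsilon(\boldsymbol v)\,dx$ and $(\boldsymbol\sigma,\boldsymbol\tau)_Q=\int_\Omega\boldsymbol\sigma\cdot\boldsymbol\tau\,dx$, where $\cdot$ is the Euclidean inner product. $V^*$ is the dual of $V$, with duality pairing $\langle\cdot,\cdot\rangle$. $\mathbf{Q}_\infty$ is the Banach space of fourth order tensors $\mathcal D=(D_{ijkl})$ with $D_{ijkl}=D_{jikl}=D_{klij}\in L^\infty(\Omega)$, normed by $\max_{i,j,k,l}\|D_{ijkl}\|_{L^\infty(\Omega)}$; it acts on $Q$ by $(\mathcal D\boldsymbol\tau)_{ij}=\sum_{k,l}D_{ijkl}\tau_{kl}$. For a normed space $X$, $C([0,T];X)$ has the maximum norm,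 and for $K\subset X$, $C([0,T];K)$ is the set of functions in $C([0,T];X)$ with values in $K$. $\boldsymbol\varepsilon^*:Q\to V^*$ is the adjoint of $\boldsymbol\varepsilon:V\to Q$: $\langle\boldsymbol\varepsilon^*(\boldsymbol\eta),\boldsymbol v\rangle=(\boldsymbol\eta,\boldsymbol\varepsilon(\boldsymbol v))_Q$. Set $\mathcal W=\boldsymbol\varepsilon^*\mathcal B\boldsymbol\varepsilon:V\to V^*$. The operator $\mathcal F:V^*\to U$ assigns to $\boldsymbol\omega\in V^*$ the unique $\boldsymbol z\in U$ with $\langle(\mathcal W+P)(\boldsymbol z),\boldsymbol v-\boldsymbol z\rangle\ge\langle\boldsymbol\omega,\boldsymbol v-\boldsymbol z\rangle$ for all $\boldsymbol v\in U$. Problem $\mathcal P$: find $\boldsymbol u:[0,T]\to V$ such that for all $t\in[0,T]$, $\boldsymbol u(t)\in U$ and $$(\mathcal{B}\boldsymbol\varepsilon(\boldsymbol u(t)),\boldsymbol\varepsilon(\boldsymbol v)-\boldsymbol\varepsilon(\boldsymbol u(t)))_Q+\Big(\int_0^t\mathcal{R}(t-s)\boldsymbol\varepsilon(\boldsymbol u(s))\,ds,\boldsymbol\varepsilon(\boldsymbol v)-\boldsymbol\varepsilon(\boldsymbol u(t))\Big)_Q+\langle P\boldsymbol u(t),\boldsymbol v-\boldsymbol u(t)\rangle\ge\langle\boldsymbol f(t),\boldsymbol v-\boldsymbol u(t)\rangle\quad\forall\,\boldsymbol v\in U.$$ Problem $\mathcal Q$: find $\boldsymbol u:[0,T]\to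 V$ such that for all $t\in[0,T]$, $\boldsymbol u(t)=\mathcal F\big[\boldsymbol f(t)-\boldsymbol\varepsilon^*\big(\int_0^t\mathcal{R}(t-s)\boldsymbol\varepsilon(\boldsymbol u(s))\,ds\big)\big]$. Under the stated hypotheses it is known that Problem $\mathcal P$ has a unique solution $\boldsymbol u\in C([0,T];U)$, and that it is also the unique solution of Problem $\mathcal Q$ in $C([0,T];U)$. A sequence $\{\boldsymbol u_n\}\subset C([0,T];V)$ is a $p$-approximating sequence if $\boldsymbol u_n(t)\in U$ for all $n\in\mathbb N$, $t\in[0,T]$, and there is a sequence of reals $0\le\varepsilon_n\to0$ such that for all $\boldsymbol v\in U$, $t\in[0,T]$, $n\in\mathbb N$ $$(\mathcal{B}\boldsymbol\varepsilon(\boldsymbol u_n(t)),\boldsymbol\varepsilon(\boldsymbol v)-\boldsymbol\varepsilon(\boldsymbol u_n(t)))_Q+\Big(\int_0^t\mathcal{R}(t-s)\boldsymbol\varepsilon(\boldsymbol u_n(s))\,ds,\boldsymbol\varepsilon(\boldsymbol v)-\boldsymbol\varepsilon(\boldsymbol u_n(t))\Big)_Q+\langle P\boldsymbol u_n(t),\boldsymbol v-\boldsymbol u_n(t)\rangle+\varepsilon_n\|\boldsymbol v-\boldsymbol u_n(t)\|_V\ge\langle\boldsymbol f(t),\boldsymbol v-\boldsymbol u_n(t)\rangle.$$ A sequence $\{\boldsymbol u_n\}\subset C([0,T];V)$ is a $q$-approximating sequence if there is a sequence of reals $0\le\varepsilon_n\to0$ such that for all $t\in[0,T]$, $n\in\mathbb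 N$ $$\Big\|\boldsymbol u_n(t)-\mathcal F\Big[\boldsymbol f(t)-\boldsymbol\varepsilon^*\Big(\int_0^t\mathcal{R}(t-s)\boldsymbol\varepsilon(\boldsymbol u_n(s))\,ds\Big)\Big]\Big\|_V\le\varepsilon_n.$$ *)

(* Defs.v *)
From HB Require Import structures.
From mathcomp Require Import all_boot all_order all_algebra.
From mathcomp Require Import generic_quotient ring_quotient ring lra.
From mathcomp Require Import all_classical all_reals all_analysis.
From mathcomp Require Import ess_sup_inf measurable_realfun.

Set Implicit Arguments.
Unset Strict Implicit.
Unset Printing Implicit Defensive.
Import Order.TTheory GRing.Theory Num.Theory.
Import numFieldNormedType.Exports.
Local Open Scope classical_set_scope.
Local Open Scope ring_scope.

(* A point of R^d is a row
   vector ['rV[R]_d].  The spaces [Lp], [Qspace], [Qinf], [Vspace] and [dual]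
   are [lmodType]s; each comes with a norm given as a plain function
   ([Q_norm], [V_norm], ...), and the topological notions below take that
   norm as an argument. *)

(* The linear subspace [P] of [E], as an [lmodType]. *)
Section submod.
Variables (R : pzRingType) (E : lmodType R) (P : submodClosed E).
Record submod := Submod { submod_val :> E; submod_valP : submod_val \in P }.
HB.instance Definition _ := [isSub for submod_val].
HB.instance Definition _ := [Choice of submod by <:].
HB.instance Definition _ := [SubChoice_isSubLmodule of submod by <:].
End submod.

Section Lp_quotient.
Context d (T : measurableType d) (R : realType).
Variables (mu : {measure set T -> \bar R}) (p : \bar R) (p1 : (1 <= p)%E).

Definition ae_null : {pred LfunType mu p1} :=
  fun f => `[< (f : T -> R) = cst 0 %[ae mu] >].

Lemma ae_nullP (f : LfunType mu p1) :
  reflect {ae mu, forall x, f x = 0} (f \in ae_null).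
Proof.
apply: (iffP idP) => [/asboolP h|h].
  by apply: filterS h => x; exact.
by apply/asboolP; apply: filterS h => x.
Qed.

Lemma ae_null_zmod_closed : zmod_closed ae_null.
Proof.
split=> [|f g /ae_nullP f0 /ae_nullP g0]; first exact/ae_nullP/nearW.
apply/ae_nullP; apply: filterS2 f0 g0 => x fx gx.
by rewrite [LHS](_ : _ = f x - g x)// fx gx subrr.
Qed.
HB.instance Definition _ :=
  GRing.isZmodClosed.Build (LfunType mu p1) ae_null ae_null_zmod_closed.

Lemma ae_nullZ a (f : LfunType mu p1) : f \in ae_null -> a *: f \in ae_null.
Proof.
move=> /ae_nullP f0; apply/ae_nullP; apply: filterS f0 => x fx.
by rewrite [LHS](_ : _ = a * f x)// fx mulr0.
Qed.

(* L^p(mu): the library's functions with finite p-norm, modulo equality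
   mu-almost everywhere. *)
Definition Lp_type : Type := Quotient.quot ae_null.
HB.instance Definition _ := GRing.Zmodule.on Lp_type.

Definition Lp_pi (f : LfunType mu p1) : Lp_type :=
  (\pi_(Quotient.quot ae_null) f)%qT.
Definition Lp_rep (f : Lp_type) : LfunType mu p1 :=
  repr (f : Quotient.quot ae_null).

Lemma Lp_repK f : Lp_pi (Lp_rep f) = f.
Proof. exact: reprK. Qed.

Lemma Lp_piP f g : Lp_pi f = Lp_pi g <-> f - g \in ae_null.
Proof.
split=> [/eqP|]; first by rewrite Quotient.idealrBE.
by rewrite Quotient.idealrBE => /eqP.
Qed.

Lemma Lp_piD f g : Lp_pi (f + g) = Lp_pi f + Lp_pi g.
Proof. by rewrite /Lp_pi raddfD. Qed.

Definition Lp_scale (a : R) (f : Lp_type) : Lp_type := Lp_pi (a *: Lp_rep f).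

Lemma Lp_piZ a f : Lp_pi (a *: f) = Lp_scale a (Lp_pi f).
Proof.
apply/Lp_piP; rewrite -scalerBr; apply: ae_nullZ.
by apply/Lp_piP; rewrite Lp_repK.
Qed.

Fact Lp_scaleA a b f : Lp_scale a (Lp_scale b f) = Lp_scale (a * b) f.
Proof. by rewrite [Lp_scale b f]/Lp_scale -Lp_piZ scalerA. Qed.
Fact Lp_scale1 : left_id 1 Lp_scale.
Proof. by move=> f; rewrite /Lp_scale scale1r Lp_repK. Qed.
Fact Lp_scaleDr : right_distributive Lp_scale +%R.
Proof.
move=> a f g; rewrite -{1}[f]Lp_repK -{1}[g]Lp_repK -Lp_piD -Lp_piZ.
by rewrite scalerDr Lp_piD.
Qed.
Fact Lp_scaleDl f : {morph Lp_scale^~ f : a b / a + b}.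
Proof. by move=> a b; rewrite /Lp_scale scalerDl Lp_piD. Qed.
HB.instance Definition _ := GRing.Zmodule_isLmodule.Build R Lp_type
  Lp_scaleA Lp_scale1 Lp_scaleDr Lp_scaleDl.

Definition Lp : lmodType R := Lp_type.
Definition Lp_class (f : LfunType mu p1) : Lp := Lp_pi f.
Definition Lp_repr (f : Lp) : LfunType mu p1 := Lp_rep f.
Definition Lp_fun (f : Lp) : T -> R := Lp_repr f.

Lemma Lp_reprK f : Lp_class (Lp_repr f) = f.
Proof. exact: Lp_repK. Qed.

Lemma Lp_classP f g :
  Lp_class f = Lp_class g <-> {ae mu, forall x, f x = g x}.
Proof.
split=> [/Lp_piP/ae_nullP|h].
  by apply: filterS => x; rewrite [LHS](_ : _ = f x - g x)// => /subr0_eq.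
apply/Lp_piP/ae_nullP; apply: filterS h => x fx.
by rewrite [LHS](_ : _ = f x - g x)// fx subrr.
Qed.

Lemma Lp_class_comb a f g :
  Lp_class (a *: f + g) = a *: Lp_class f + Lp_class g.
Proof. by rewrite {1}/Lp_class Lp_piD Lp_piZ. Qed.

Lemma Lp_class0 : Lp_class 0 = 0.
Proof. by rewrite /Lp_class /Lp_pi raddf0. Qed.

Lemma Lp_class_ae f : {ae mu, forall x, Lp_fun (Lp_class f) x = f x}.
Proof. by apply/Lp_classP; rewrite Lp_reprK. Qed.

Lemma Lp_ae_comb a (f g : Lp) :
  {ae mu, forall x, Lp_fun (a *: f + g) x = a * Lp_fun f x + Lp_fun g x}.
Proof.
by have := Lp_class_ae (a *: Lp_repr f + Lp_repr g); rewrite Lp_class_comb !Lp_reprK.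
Qed.

Lemma Lp_ae0 : {ae mu, forall x, Lp_fun 0 x = 0}.
Proof. by have := Lp_class_ae 0; rewrite Lp_class0. Qed.

Lemma Lp_fun_measurable (f : Lp) : measurable_fun setT (Lp_fun f).
Proof. exact: measurable_funPT. Qed.

End Lp_quotient.
Notation Linf mu := (Lp mu (leey 1%E)).
Notation L2 mu := (Lp mu (lee1n 2)).

Section Lp_products.
Context d (T : measurableType d) (R : realType).
Variable mu : {measure set T -> \bar R}.

Local Notation Linf := (Lp mu (leey 1%E)).
Local Notation L2 := (Lp mu (lee1n 2)).

Definition Linf_norm (a : Linf) : R := fine ('N[mu]_+oo[EFin \o Lp_fun a])%E.

Definition L2_ip (f g : L2) : R := \int[mu]_x (Lp_fun f x * Lp_fun g x).

Lemma LfunM_Linf_L2 (a : LfunType mu (leey 1%E)) (f : LfunType mu (lee1n 2)) :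
  (fun x => a x * f x) \in Lfun mu 2%:R%:E.
Proof.
have [M aM] : exists M : R, {ae mu, forall x, `|a x| <= M}.
  have [mu0|mu0] := eqVneq (mu setT) 0%E.
    exists 0; exists setT; split => //.
  have := Lfunction_finite _ a; rewrite /finite_norm unlock /Lnorm.
  rewrite lt0e mu0 measure_ge0/= => /ess_supr_bounded[M fM].
  by exists M; apply: filterS fM.
have := LfunP (M *: f); rewrite !inE => /andP[]; rewrite !inE /=.
move=> _ finMf; apply/andP; split; rewrite inE/=.
  exact: measurable_funM.
apply: le_lt_trans finMf; rewrite unlock /Lnorm.
apply: gt0_ler_poweR.
- by rewrite invr_ge0.
- by rewrite in_itv/= leey integral_ge0// => x _; exact: poweR_ge0.
- by rewrite in_itv/= leey integral_ge0// => x _; exact: poweR_ge0.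
apply: ae_ge0_le_integral => //.
- by move=> x _; exact: poweR_ge0.
- apply/measurable_EFinP.
  apply: (@measurableT_comp _ _ _ _ _ _ (fun x : R => x `^ 2)%R) => //.
  by apply: measurableT_comp => //; exact: measurable_funM.
- by move=> x _; exact: poweR_ge0.
- apply/measurable_EFinP.
  apply: (@measurableT_comp _ _ _ _ _ _ (fun x : R => x `^ 2)%R) => //.
  by apply: measurableT_comp => //; exact: measurable_funM.
apply: filterS aM => x aM _ /=.
rewrite lee_fin ge0_ler_powR ?nnegrE//.
rewrite normrM [`|_ *: _|]normrM ler_wpM2r// (le_trans aM)// ler_norm//.
Qed.

Definition Linf_act (a : Linf) (f : L2) : L2 :=
  Lp_class (Lfun_Sub (lee1n 2) (LfunM_Linf_L2 (Lp_repr a) (Lp_repr f))).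

Lemma L2_integrableM (f g : LfunType mu (lee1n 2)) :
  mu.-integrable setT (EFin \o (fun x => f x * g x)).
Proof.
apply/Lfun1_integrable/Lfun2_mul_Lfun1; exact: LfunP.
Qed.

Lemma L2_ipC f g : L2_ip f g = L2_ip g f.
Proof. by apply: eq_Rintegral => x _; rewrite mulrC. Qed.

Lemma L2_ip_class (f g : LfunType mu (lee1n 2)) :
  L2_ip (Lp_class f) (Lp_class g) = \int[mu]_x (f x * g x).
Proof.
rewrite /L2_ip /Rintegral; congr fine; apply: ae_eq_integral => //.
- have := L2_integrableM (Lp_repr (Lp_class f)) (Lp_repr (Lp_class g)).
  by case/integrableP.
- by have /integrableP[] := L2_integrableM f g.
by apply: filterS2 (Lp_class_ae f) (Lp_class_ae g) => x fx gx _; rewrite /= fx gx.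
Qed.

Lemma L2_ipP f a g h : L2_ip f (a *: g + h) = a * L2_ip f g + L2_ip f h.
Proof.
rewrite -[f]Lp_reprK -[g]Lp_reprK -[h]Lp_reprK -Lp_class_comb.
move: (Lp_repr f) (Lp_repr g) (Lp_repr h) => {}f {}g {}h.
rewrite !L2_ip_class -RintegralZl//; last exact: L2_integrableM.
rewrite -RintegralD//; first last.
- exact: L2_integrableM.
- have := L2_integrableM f (a *: g); apply: eq_integrable => // x _ /=.
  by rewrite mulrCA.
by apply: eq_Rintegral => x _; rewrite -mulrCA -mulrDr.
Qed.

Lemma L2_ip_ge0 f : 0 <= L2_ip f f.
Proof. by apply: Rintegral_ge0 => x _; rewrite -expr2 sqr_ge0. Qed.

End Lp_products.

Section cover_measure.
Variables (R : realType) (T : pointedType).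

(* A copy of [T] in which every set is measurable, so that [mu_ext] ranges
   over all countable covers. *)
Definition powerset_type (T : Type) : Type := T.
HB.instance Definition _ := Pointed.on (powerset_type T).
HB.instance Definition _ := @isMeasurable.Build default_measure_display
  (powerset_type T) (@discrete_measurable T) (@discrete_measurable0 T)
  (@discrete_measurableC T) (@discrete_measurableU T).


Variable gauge : set T -> \bar R.
Definition cover_measure (X : set T) : \bar R :=
  mu_ext (gauge : set (powerset_type T) -> \bar R) X.

Hypotheses (gauge0 : gauge set0 = 0%E) (gauge_ge0 : forall X, (0 <= gauge X)%E).
Lemma cover_measure0 : cover_measure set0 = 0%E.
Proof. exact: (@mu_ext0 _ (powerset_type T)). Qed.
Lemma cover_measure_ge0 X : (0 <= cover_measure X)%E.
Proof. exact: (@mu_ext_ge0 _ (powerset_type T)). Qed.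
Lemma le_cover_measure : {homo cover_measure : A B / A `<=` B >-> (A <= B)%E}.
Proof. exact: (@le_mu_ext _ (powerset_type T)). Qed.
Lemma cover_measure_sigma_subadditive : sigma_subadditive cover_measure.
Proof. exact: (@mu_ext_sigma_subadditive _ (powerset_type T)). Qed.
End cover_measure.

(* For [D] Caratheodory-measurable, the Caratheodory measure space of
   [outer_restr mu D] is the restriction of that of [mu] to [D]. *)
Section outer_restr.
Variables (R : realType) (T : Type).
Variables (mu : {outer_measure set T -> \bar R}) (D : set T).
Definition outer_restr (X : set T) : \bar R := mu (X `&` D).
Fact outer_restr0 : outer_restr set0 = 0%E.
Proof. by rewrite /outer_restr set0I. Qed.
Fact outer_restr_ge0 X : (0 <= outer_restr X)%E.
Proof. exact: outer_measure_ge0. Qed.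
Fact le_outer_restr : {homo outer_restr : A B / A `<=` B >-> (A <= B)%E}.
Proof. by move=> A B AB; apply: le_outer_measure; exact: setSI. Qed.
Fact outer_restr_sigma_subadditive : sigma_subadditive outer_restr.
Proof.
move=> F; rewrite /outer_restr setI_bigcupl.
exact: outer_measure_sigma_subadditive.
Qed.
HB.instance Definition _ := isOuterMeasure.Build R T outer_restr
  outer_restr0 outer_restr_ge0 le_outer_restr outer_restr_sigma_subadditive.
End outer_restr.

Section euclidean_measures.
Context {R : realType} {d : nat}.
Local Notation E := 'rV[R]_d.

Definition box (a b : E) : set E :=
  [set x | forall i, a ord0 i <= x ord0 i <= b ord0 i].

(* The least volume of a closed box containing [A]. *)
Definition box_gauge (A : set E) : \bar R :=
  if `[< A = set0 >] then 0%E else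
  ereal_inf [set y | exists a b : E, [/\ forall i, a ord0 i <= b ord0 i,
    A `<=` box a b & y = (\prod_i (b ord0 i - a ord0 i))%:E]].

Fact box_gauge0 : box_gauge set0 = 0%E.
Proof. by rewrite /box_gauge asboolT. Qed.
Fact box_gauge_ge0 A : (0 <= box_gauge A)%E.
Proof.
rewrite /box_gauge; case: ifP => // _.
apply: le_ereal_inf_tmp => _ [a [b [ab _ ->]]].
by rewrite lee_fin prodr_ge0// => i _; rewrite subr_ge0.
Qed.

(* Lebesgue outer measure on R^d, for d >= 1. *)
Definition lebesgue_outer : set E -> \bar R := cover_measure box_gauge.
HB.instance Definition _ := isOuterMeasure.Build R E lebesgue_outer
  (cover_measure0 box_gauge0 box_gauge_ge0) (cover_measure_ge0 box_gauge_ge0)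
  (@le_cover_measure R E box_gauge) (cover_measure_sigma_subadditive box_gauge_ge0).

Definition enorm (x : E) : R := Num.sqrt (\sum_i x ord0 i ^+ 2).

Definition diam_gauge (s : nat) (delta : R) (A : set E) : \bar R :=
  if `[< A = set0 >] then 0%E else
  if `[< forall x y, A x -> A y -> enorm (x - y) <= delta >]
  then ((sup [set r | exists x y, [/\ A x, A y & r = enorm (x - y)]]) ^+ s)%:E
  else +oo%E.

Fact diam_gauge0 s delta : diam_gauge s delta set0 = 0%E.
Proof. by rewrite /diam_gauge asboolT. Qed.
Fact diam_gauge_ge0 s delta A : (0 <= diam_gauge s delta A)%E.
Proof.
rewrite /diam_gauge; case: ifP => // _; case: ifP => // _.
rewrite lee_fin exprn_ge0//; set S := (X in sup X).
have [supS|] := pselect (has_sup S); last by move/sup_out => ->.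
have [r Sr] := supS.1.
apply: (le_trans _ (ub_le_sup supS.2 Sr)).
by move: Sr => [x [y [_ _ ->]]]; exact: sqrtr_ge0.
Qed.

(* s-dimensional Hausdorff measure for the Euclidean distance, without the
   usual normalising constant: only its null sets, its positivity and its
   L^2 convergence are used.  On a smooth hypersurface it is a constant
   multiple of surface measure; for [s = 0] it is counting measure. *)
Definition hausdorff_outer (s : nat) (X : set E) : \bar R :=
  ereal_sup [set cover_measure (diam_gauge s delta) X | delta in [set r | 0 < r]].

Fact le_hausdorff s delta X : 0 < delta ->
  (cover_measure (diam_gauge s delta) X <= hausdorff_outer s X)%E.
Proof. by move=> d0; apply: ereal_sup_ubound; exists delta. Qed.

Section hausdorff_is_outer.
Variable s : nat.
Fact hausdorff_outer0 : hausdorff_outer s set0 = 0%E.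
Proof.
apply/eqP; rewrite eq_le; apply/andP; split.
  apply: ge_ereal_sup => _ [delta _ <-].
  by rewrite (cover_measure0 (diam_gauge0 s delta) (diam_gauge_ge0 s delta)).
apply: le_trans (le_hausdorff _ _ ltr01).
exact: cover_measure_ge0 (diam_gauge_ge0 s 1) _.
Qed.
Fact hausdorff_outer_ge0 X : (0 <= hausdorff_outer s X)%E.
Proof.
apply: le_trans (le_hausdorff _ _ ltr01).
exact: cover_measure_ge0 (diam_gauge_ge0 s 1) _.
Qed.
Fact le_hausdorff_outer : {homo hausdorff_outer s : A B / A `<=` B >-> (A <= B)%E}.
Proof.
move=> A B AB; apply: ge_ereal_sup => _ [delta d0 <-].
by apply: le_trans (le_hausdorff _ _ d0); exact: le_cover_measure.
Qed.
Fact hausdorff_outer_sigma_subadditive : sigma_subadditive (hausdorff_outer s).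
Proof.
move=> F; apply: ge_ereal_sup => _ [delta d0 <-].
apply: le_trans (cover_measure_sigma_subadditive (diam_gauge_ge0 s delta) _) _.
apply: lee_nneseries => i _; first by move=> _; exact: cover_measure_ge0 (diam_gauge_ge0 s delta) _.
exact: le_hausdorff.
Qed.
HB.instance Definition _ := isOuterMeasure.Build R E (hausdorff_outer s)
  hausdorff_outer0 hausdorff_outer_ge0 le_hausdorff_outer
  hausdorff_outer_sigma_subadditive.
End hausdorff_is_outer.

Definition lebesgue_on (Om : set E) : {outer_measure set E -> \bar R} :=
  outer_restr lebesgue_outer Om.
Definition surface_on (G : set E) : {outer_measure set E -> \bar R} :=
  outer_restr (hausdorff_outer d.-1) G.
Definition mlebesgue (Om : set E) :
  {measure set (caratheodory_type (lebesgue_on Om)) -> \bar R} := lebesgue_on Om.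
Definition msurface (G : set E) :
  {measure set (caratheodory_type (surface_on G)) -> \bar R} := surface_on G.
End euclidean_measures.

Section normed_notions.
Context {R : realType}.

Definition continuous_wrt {X Y : zmodType} (N : X -> R) (M : Y -> R) (g : X -> Y) :=
  forall x e, 0 < e ->
    exists2 delta, 0 < delta & forall y, N (y - x) < delta -> M (g y - g x) < e.

Definition closed_wrt {X : zmodType} (N : X -> R) (A : set X) :=
  forall x, (forall e, 0 < e -> exists2 y, A y & N (y - x) < e) -> A x.

Definition lipschitz_wrt {X Y : zmodType} (N : X -> R) (M : Y -> R) (g : X -> Y) :=
  exists L, forall x y, M (g x - g y) <= L * N (x - y).

(* [u] is an element of C([0,T];X); only its values on [0,T] matter. *)
Definition in_C {X : zmodType} (N : X -> R) (T : R) (u : R -> X) :=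
  forall t, t \in `[0, T] -> N (u s - u t) @[s --> within `[0, T] (nbhs t)] --> 0.

Definition C_norm {X : zmodType} (N : X -> R) (T : R) (u : R -> X) : R :=
  sup [set N (u t) | t in `[0, T]].

Definition C_cvg {X : zmodType} (N : X -> R) (T : R) (un : nat -> R -> X) (u : R -> X) :=
  C_norm N T (un n \- u) @[n --> \oo] --> 0.

(* Riemann integral of an [X]-valued function over [a, b]: the limit, in the
   norm [N], of the tagged sums as the mesh tends to 0. *)
Definition is_vint {X : lmodType R} (N : X -> R) (a b : R) (g : R -> X) (l : X) :=
  forall e, 0 < e -> exists2 delta, 0 < delta &
    forall (k : nat) (x xi : nat -> R), x 0%N = a -> x k = b ->
      (forall i, (i < k)%N -> x i <= xi i <= x i.+1 /\ x i.+1 - x i < delta) ->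
      N (\sum_(i < k) (x i.+1 - x i) *: g (xi i) - l) < e.

Definition vint {X : lmodType R} (N : X -> R) (a b : R) (g : R -> X) : X :=
  xget 0 [set l | is_vint N a b g l].

End normed_notions.

Section dual.
Context {R : realType} (X : lmodType R) (N : X -> R).

Definition dual_pred : {pred X -> R^o} := fun w =>
  `[< (forall a x y, w (a *: x + y) = a * w x + w y) /\
      exists C, forall x, `|w x| <= C * N x >].

Lemma dual_predP w : w \in dual_pred <->
  (forall a x y, w (a *: x + y) = a * w x + w y) /\
  exists C, forall x, `|w x| <= C * N x.
Proof. by split => [/asboolP|h]; [|exact/asboolP]. Qed.

Lemma dual_submod_closed : submod_closed dual_pred.
Proof.
split.
  apply/dual_predP; split=> [a x y|]; first by rewrite mulr0 addr0.
  by exists 0 => x; rewrite normr0 mul0r.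
move=> a w w' /dual_predP[lw [C wC]] /dual_predP[lw' [C' wC']].
have E x : (a *: w + w') x = a * w x + w' x by [].
apply/dual_predP; split=> [b x y|].
  by rewrite !E lw lw'; ring.
exists (`|a| * C + C') => x; rewrite E.
rewrite (le_trans (ler_normD _ _))// normrM mulrDl -mulrA lerD//.
by rewrite ler_wpM2l.
Qed.
HB.instance Definition _ :=
  GRing.isSubmodClosed.Build R (X -> R^o) dual_pred dual_submod_closed.

Definition dual : lmodType R := submod dual_pred.
Definition pairing (w : dual) (x : X) : R := submod_val w x.

Definition dual_norm (w : dual) : R :=
  sup [set `|pairing w x| | x in [set x | N x <= 1]].
End dual.

Section domains.
Context {R : realType} {d : nat}.
Local Notation E := 'rV[R]_d.

Definition partial (i : 'I_d) (phi : E -> R) : E -> R :=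
  fun x => 'D_(delta_mx ord0 i) phi x.

Definition iter_partial (s : seq 'I_d) (phi : E -> R) : E -> R :=
  foldr partial phi s.

Definition smooth (phi : E -> R) := forall s : seq 'I_d,
  continuous (iter_partial s phi) /\
  forall i x, derivable (iter_partial s phi) x (delta_mx ord0 i).

Definition frontier (Om : set E) : set E := closure Om `\` interior Om.

(* Near each boundary point, [Om] is the negativity set of a smooth function
   whose gradient does not vanish at that point. *)
Definition smooth_boundary (Om : set E) :=
  forall x, frontier Om x -> exists (rho : E -> R) (W : set E),
    [/\ smooth rho, exists i, partial i rho x != 0, nbhs x W &
        forall y, W y -> (Om y <-> rho y < 0)].

Definition smooth_bounded_domain (Om : set E) :=
  [/\ open Om, connected Om, Om !=set0, bounded_set Om & smooth_boundary Om].

Definition test_function (Om : set E) (phi : E -> R) :=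
  smooth phi /\ exists K : set E, [/\ compact K, K `<=` Om &
    forall x, ~ K x -> phi x = 0].

Lemma iter_partial_comb s a (phi psi : E -> R) : smooth phi -> smooth psi ->
  iter_partial s (fun x => a * phi x + psi x) =
  (fun x => a * iter_partial s phi x + iter_partial s psi x).
Proof.
move=> sphi spsi; elim: s => //= i s ->; apply/funext => x.
rewrite /partial.
have d1 := (sphi s).2 i x; have d2 := (spsi s).2 i x.
have -> : (fun x => a * iter_partial s phi x + iter_partial s psi x) =
  (a *: iter_partial s phi) + iter_partial s psi by [].
rewrite deriveD; [|exact: derivableZ|exact: d2].
by rewrite deriveZ; [|exact: d1].
Qed.

Lemma smooth_comb a (phi psi : E -> R) : smooth phi -> smooth psi ->
  smooth (fun x => a * phi x + psi x).
Proof.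
move=> sphi spsi s; rewrite iter_partial_comb//.
have [cphi dphi] := sphi s; have [cpsi dpsi] := spsi s.
have -> : (fun x => a * iter_partial s phi x + iter_partial s psi x) =
  (a *: iter_partial s phi) + iter_partial s psi by [].
split=> [x|i x].
  apply: continuousD; last exact: cpsi.
  by apply: continuousZr; exact: cphi.
by apply: derivableD; [apply: derivableZ; exact: dphi|exact: dpsi].
Qed.

Lemma smooth0 : smooth (fun _ : E => 0 : R).
Proof.
have E0 s : iter_partial s (fun _ : E => 0 : R) = (fun=> 0).
  by elim: s => //= i s ->; apply/funext => x; rewrite /partial derive_cst.
move=> s; rewrite E0; split=> [x|i x]; first exact: cst_continuous.
exact: derivable_cst.
Qed.

End domains.

Section Lp_convergence.
Context d (T : measurableType d) (R : realType).
Variable mu : {measure set T -> \bar R}.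

Definition Lp_cvg (p : \bar R) (fn : nat -> T -> R) (f : T -> R) :=
  (forall n, fn n \- f \in Lfun mu p) /\
  ('N[mu]_p[EFin \o (fn n \- f)%R])%E @[n --> \oo] --> 0%E.

Definition ae_zero_on (A : set T) (g : T -> R) :=
  {ae mu, forall x, A x -> g x = 0}.

Lemma Lp_cvg_comb a
    (fn gn : nat -> T -> R) (f g h : T -> R) :
  measurable_fun setT (fun x => h x - (a * f x + g x)) ->
  {ae mu, forall x, h x = a * f x + g x} ->
  Lp_cvg 2%:E fn f -> Lp_cvg 2%:E gn g ->
  Lp_cvg 2%:E (fun n x => a * fn n x + gn n x) h.
Proof.
set k := fun x => h x - _ => mk k0 [fnL fn0] [gnL gn0].
have p1 : (1 <= 2%:E :> \bar R)%E by rewrite lee1n.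
have Nk : ('N[mu]_2%:E[EFin \o k] = 0)%E.
  have N0 : ('N[mu]_2%:E[cst 0] = 0)%E by apply: Lnorm0.
  rewrite -{}N0 unlock; apply: (congr1 (fun z => z `^ _)%E).
  have mp : measurable_fun setT (fun x : R => x `^ 2)%R.
    exact: measurable_powR.
  apply: ae_eq_integral => //.
  - apply/measurable_EFinP.
    by apply: (measurableT_comp mp); exact: measurableT_comp.
  - by apply: filterS k0 => x kx _; rewrite /= /k kx subrr.
have kL : k \in Lfun mu 2%:E.
  rewrite inE; apply/andP; split; rewrite inE//=.
  by rewrite /finite_norm Nk ltry.
pose F n : LfunType mu p1 := Lfun_Sub p1 (fnL n).
pose G n : LfunType mu p1 := Lfun_Sub p1 (gnL n).
pose K : LfunType mu p1 := Lfun_Sub p1 kL.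
have E n : (fun x => a * fn n x + gn n x) \- h = (a *: F n + G n - K : LfunType mu p1).
  by apply/funext => x; rewrite [RHS](_ : _ =
    a * (fn n x - f x) + (gn n x - g x) - (h x - (a * f x + g x)))//=; ring.
split=> [n|]; first by rewrite E; exact: LfunP.
apply: (@squeeze_cvge _ _ _ R (cst 0%E) _
  (fun n => `|a|%:E * 'N[mu]_2%:E[EFin \o (fn n \- f)%R] +
            'N[mu]_2%:E[EFin \o (gn n \- g)%R])%E).
- apply: nearW => n; rewrite Lnorm_ge0/= E.
  have h1 : ('N[mu]_2%:E[EFin \o (a *: F n + G n - K : LfunType mu p1)%R] <=
     'N[mu]_2%:E[EFin \o (a *: F n + G n : LfunType mu p1)%R] +
     'N[mu]_2%:E[EFin \o (- K : LfunType mu p1)%R])%E.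
    by apply: eminkowski; [exact: measurable_funPT|exact: measurable_funPT|exact: p1].
  apply: (le_trans h1).
  have -> : ('N[mu]_2%:E[EFin \o (- K : LfunType mu p1)%R] = 0)%E.
    by rewrite -[RHS]Nk -[RHS]oppe_Lnorm.
  rewrite adde0.
  have h2 : ('N[mu]_2%:E[EFin \o (a *: F n + G n : LfunType mu p1)%R] <=
     'N[mu]_2%:E[EFin \o (a *: F n : LfunType mu p1)%R] +
     'N[mu]_2%:E[EFin \o (G n : LfunType mu p1)%R])%E.
    by apply: eminkowski; [exact: measurable_funPT|exact: measurable_funPT|exact: p1].
  by apply: (le_trans h2); rewrite leeD2r// LnormZ.
- exact: cvg_cst.
- rewrite [X in _ --> X](_ : _ = `|a|%:E * 0 + 0)%E; last by rewrite mule0 adde0.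
  by apply: cvgeD => //; exact: cvgeZl.
Qed.

Lemma integrable_ae_eq (f g : T -> \bar R) : measurable_fun setT g -> ae_eq mu setT f g ->
  mu.-integrable setT f -> mu.-integrable setT g.
Proof.
move=> mg fg /integrableP[mf foo]; apply/integrableP; split => //.
rewrite (_ : \int[mu]_x `|g x| = \int[mu]_x `|f x|)%E//.
apply: ae_eq_integral => //; [exact: measurableT_comp|exact: measurableT_comp|].
by apply: filterS fg => x /= + _ => ->.
Qed.

Lemma Lp_cvg0 (h : T -> R) :
  measurable_fun setT h -> {ae mu, forall x, h x = 0} ->
  Lp_cvg 2%:E (fun n x => 0 : R) h.
Proof.
move=> mh h0.
have c0 : Lp_cvg 2%:E (fun n x => 0 : R) (fun x => 0 : R).
  have E : (fun=> 0 : R) \- (fun=> 0) = (fun=> 0) :> (T -> R).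
    by apply/funext => x /=; rewrite subrr.
  split=> [n|]; rewrite E.
    exact: (LfunP (0 : LfunType mu (lee1n 2))).
  under eq_fun do rewrite (Lnorm0 mu)//.
  exact: cvg_cst.
rewrite (_ : (fun (n : nat) (x : T) => 0 : R) = (fun n x => 0 * 0 + 0)); last first.
  by apply/funext => n; apply/funext => x; rewrite mulr0 addr0.
apply: (@Lp_cvg_comb 0 (fun n x => 0) (fun n x => 0) _ _ h _ _ c0 c0).
  rewrite (_ : (fun x => _) = h)//.
  by apply/funext => x; rewrite mulr0 addr0 subr0.
by apply: filterS h0 => x ->; rewrite mulr0 addr0.
Qed.

End Lp_convergence.

Section jet.
Context {R : realType} (d : nat) (L : lmodType R).
(* Pairs of a vector field and a matrix field, i.e. a candidate for its
   gradient: [jgrad w i j] is the j-th partial derivative of [jval w i]. *)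
Definition jet : lmodType R := (('I_d -> L) * ('I_d -> 'I_d -> L))%type.
Definition jval (w : jet) (i : 'I_d) : L := w.1 i.
Definition jgrad (w : jet) (i j : 'I_d) : L := w.2 i j.
Lemma jval_comb a w w' i : jval (a *: w + w') i = a *: jval w i + jval w' i.
Proof. by []. Qed.
Lemma jgrad_comb a w w' i j :
  jgrad (a *: w + w') i j = a *: jgrad w i j + jgrad w' i j.
Proof. by []. Qed.
Lemma jval0 i : jval 0 i = 0. Proof. by []. Qed.
Lemma jgrad0 i j : jgrad 0 i j = 0. Proof. by []. Qed.
End jet.

Section Vspace.
Context {R : realType} {d : nat} (Om Gam1 : set 'rV[R]_d).
Local Notation E := 'rV[R]_d.
Local Notation L2Om := (L2 (mlebesgue Om)).

(* [g] is the i-th weak derivative of [v] in [Om].  The integrability clause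
   is automatic and only says that the integral is a genuine one. *)
Definition weak_partial (i : 'I_d) (v g : L2Om) :=
  forall phi, test_function Om phi ->
    let h x := Lp_fun v x * partial i phi x + Lp_fun g x * phi x in
    (mlebesgue Om).-integrable setT (EFin \o h) /\
    \int[mlebesgue Om]_x h x = 0.

(* [g] is the trace on the boundary of [v] in H^1(Om), whose gradient is [Dv]:
   the L^2(boundary) limit of the boundary values of smooth functions
   converging to [v] in H^1(Om). *)
Definition has_trace (v : L2Om) (Dv : 'I_d -> L2Om) (g : E -> R) :=
  exists phi : nat -> E -> R, [/\ forall n, smooth (phi n),
    Lp_cvg (mlebesgue Om) 2%:E phi (Lp_fun v),
    forall i, Lp_cvg (mlebesgue Om) 2%:E (fun n => partial i (phi n)) (Lp_fun (Dv i)) &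
    Lp_cvg (msurface (frontier Om)) 2%:E phi g].

Definition zero_trace (v : L2Om) (Dv : 'I_d -> L2Om) :=
  exists2 g, has_trace v Dv g & ae_zero_on (msurface (frontier Om)) Gam1 g.

Lemma L2_measurable_comb (a : R) (f g : L2Om) :
  measurable_fun setT (fun x => Lp_fun (a *: f + g) x - (a * Lp_fun f x + Lp_fun g x)).
Proof.
apply: measurable_funB; first exact: Lp_fun_measurable.
apply: measurable_funD; last exact: Lp_fun_measurable.
by apply: measurable_funM => //; exact: Lp_fun_measurable.
Qed.

Lemma weak_partial_comb i a v g w h : weak_partial i v g -> weak_partial i w h ->
  weak_partial i (a *: v + w) (a *: g + h).
Proof.
move=> vg wh phi tphi; set hh := fun x => _.
have [iv v0] := vg _ tphi; have [iw w0] := wh _ tphi.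
set hv := fun x => _ in iv v0; set hw := fun x => _ in iw w0.
have hE : {ae mlebesgue Om, forall x, a * hv x + hw x = hh x}.
  apply: filterS2 (Lp_ae_comb a v w) (Lp_ae_comb a g h) => x vw gh.
  by rewrite /hh /hv /hw vw gh; ring.
have ivw : (mlebesgue Om).-integrable setT (EFin \o (fun x => a * hv x + hw x)).
  rewrite (_ : _ \o _ = (fun x => a%:E * (EFin \o hv) x)%E \+ (EFin \o hw))//.
  by apply: integrableD => //; exact: integrableZl.
have mvw : measurable_fun setT (EFin \o hh).
  apply: (@ae_measurable_fun _ _ _ (mlebesgue Om) _ _ (EFin \o (fun x => a * hv x + hw x))).
  - exact: measure_is_complete_caratheodory.
  - by apply: filterS hE => x /= -> .
  - by case/integrableP: ivw.
have ae1 : ae_eq (mlebesgue Om) setT (EFin \o (fun x => a * hv x + hw x)) (EFin \o hh).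
  by apply: filterS hE => x /= ->.
split.
  exact: integrable_ae_eq mvw ae1 ivw.
have mvw' : measurable_fun setT (EFin \o (fun x => a * hv x + hw x)).
  by case/integrableP: ivw.
have -> : \int[mlebesgue Om]_x hh x = \int[mlebesgue Om]_x (a * hv x + hw x).
  by rewrite /Rintegral; congr fine; apply: ae_eq_integral => //; exact: ae_eq_sym.
rewrite RintegralD//; last first.
  by rewrite (_ : _ \o _ = (fun x => a%:E * (EFin \o hv) x)%E)//; exact: integrableZl.
by rewrite RintegralZl// v0 w0 mulr0 addr0.
Qed.

Lemma has_trace_comb a v Dv g w Dw h : has_trace v Dv g -> has_trace w Dw h ->
  has_trace (a *: v + w) (fun i => a *: Dv i + Dw i) (fun x => a * g x + h x).
Proof.
move=> [phi [sphi phiv phiD phig]] [psi [spsi psiw psiD psih]].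
exists (fun n x => a * phi n x + psi n x); split.
- by move=> n; exact: smooth_comb.
- apply: Lp_cvg_comb phiv psiw; first exact: L2_measurable_comb.
  exact: Lp_ae_comb.
- move=> i.
  rewrite (_ : (fun n => _) = (fun n x => a * partial i (phi n) x + partial i (psi n) x)); last first.
    by apply/funext => n; exact: (@iter_partial_comb R d [:: i]).
  apply: Lp_cvg_comb (phiD i) (psiD i); first exact: L2_measurable_comb.
  exact: Lp_ae_comb.
- apply: Lp_cvg_comb phig psih; last exact/nearW.
  under eq_fun do rewrite subrr; exact: measurable_cst.
Qed.

Lemma zero_trace_comb a v Dv w Dw : zero_trace v Dv -> zero_trace w Dw ->
  zero_trace (a *: v + w) (fun i => a *: Dv i + Dw i).
Proof.
move=> [g tg g0] [h th h0]; exists (fun x => a * g x + h x).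
  exact: has_trace_comb.
apply: filterS2 g0 h0 => x gx hx G1x.
by rewrite gx// hx// mulr0 addr0.
Qed.

Lemma zero_trace0 : zero_trace 0 (fun=> 0).
Proof.
exists (fun=> 0); last exact/nearW.
exists (fun=> fun=> 0); split.
- by move=> _; exact: smooth0.
- by apply: Lp_cvg0; [exact: Lp_fun_measurable|exact: Lp_ae0].
- move=> j; rewrite (_ : (fun n => _) = (fun _ _ => 0)).
    by apply: Lp_cvg0; [exact: Lp_fun_measurable|exact: Lp_ae0].
  by apply/funext => n; apply/funext => x; rewrite /partial derive_cst.
- by apply: Lp_cvg0; [exact: measurable_cst|exact/nearW].
Qed.

Lemma weak_partial0 j : weak_partial j 0 0.
Proof.
move=> phi tphi; set hh := fun x => _.
have hE : ae_eq (mlebesgue Om) setT (cst 0%E) (EFin \o hh).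
  apply: filterS (Lp_ae0 (mlebesgue Om) (lee1n 2)) => x v0 _.
  by rewrite /hh /= v0 !mul0r addr0.
have mhh : measurable_fun setT (EFin \o hh).
  apply: (ae_measurable_fun _ hE); last exact: measurable_cst.
  exact: measure_is_complete_caratheodory.
split; first by apply: (integrable_ae_eq mhh hE); exact: integrable0.
transitivity (fine (\int[mlebesgue Om]_x cst 0 x)%E); last by rewrite integral0.
by rewrite /Rintegral; congr fine; apply: ae_eq_integral => //; exact: ae_eq_sym.
Qed.

(* H^1(Om)^d is represented as the graph of the weak gradient: a field [v] is
   stored together with its weak derivatives, which it determines. *)
Definition V_pred : {pred jet d L2Om} := fun w =>
  `[< forall i, zero_trace (jval w i) (jgrad w i) /\
      forall j, weak_partial j (jval w i) (jgrad w i j) >].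

Lemma V_predP w : w \in V_pred <-> forall i, zero_trace (jval w i) (jgrad w i) /\
  forall j, weak_partial j (jval w i) (jgrad w i j).
Proof. by split => [/asboolP|h]; [|exact/asboolP]. Qed.

Lemma V_submod_closed : submod_closed V_pred.
Proof.
split; last first.
  move=> a v w /V_predP vV /V_predP wV; apply/V_predP => i; split.
    rewrite jval_comb (_ : jgrad _ _ = fun j => a *: jgrad v i j + jgrad w i j).
      exact: zero_trace_comb (vV i).1 (wV i).1.
    by apply/funext => j; rewrite jgrad_comb.
  move=> j; rewrite jval_comb jgrad_comb.
  by apply: weak_partial_comb; [exact: (vV i).2|exact: (wV i).2].
apply/V_predP => i; split=> [|j].
  rewrite jval0 (_ : jgrad _ _ = fun=> 0); first exact: zero_trace0.
  by apply/funext => j; rewrite jgrad0.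
by rewrite jval0 jgrad0; exact: weak_partial0.
Qed.
HB.instance Definition _ :=
  GRing.isSubmodClosed.Build R (jet d L2Om) V_pred V_submod_closed.

Definition Vspace : lmodType R := submod V_pred.
Definition grad (v : Vspace) (i j : 'I_d) : L2Om := jgrad (submod_val v) i j.
Lemma grad_comb a (u v : Vspace) i j :
  grad (a *: u + v) i j = a *: grad u i j + grad v i j.
Proof. exact: jgrad_comb. Qed.
End Vspace.

Section sip.
Context {R : realType} (X : lmodType R) (b : X -> X -> R).
Hypotheses (bC : forall x y, b x y = b y x) (b_ge0 : forall x, 0 <= b x x)
  (bP : forall x a y z, b x (a *: y + z) = a * b x y + b x z).

Lemma sip_CS x y : `|b x y| <= Num.sqrt (b x x) * Num.sqrt (b y y).
Proof.
have key s : 0 <= b x x + s * b x y *+ 2 + s ^+ 2 * b y y.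
  have := b_ge0 (s *: y + x); rewrite bP bC bP [b (s *: y + x) x]bC bP (bC y x).
  by congr (0 <= _); ring.
rewrite -sqrtrM// -sqrtr_sqr ler_wsqrtr//.
have [y0|y0] := eqVneq (b y y) 0.
  have [->|xy0] := eqVneq (b x y) 0; first by rewrite expr0n y0 mulr0.
  have := key (- (b x x + 1) / (b x y *+ 2)).
  rewrite y0 mulr0 addr0.
  rewrite [X in _ + X](_ : _ = - (b x x + 1)); last by field; rewrite xy0.
  by rewrite opprD addrA subrr add0r oppr_ge0 ler10.
have ypos : 0 < b y y by rewrite lt_def y0 b_ge0.
have := key (- b x y / b y y).
rewrite [X in 0 <= X](_ : _ = (b x x * b y y - b x y ^+ 2) / b y y); last by field.
by rewrite pmulr_lge0 ?invr_gt0// subr_ge0.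
Qed.
End sip.

Section symmetric_tensors.
Context {R : realType} (I : Type) (L : lmodType R).

Definition sym2_pred : {pred I -> I -> L} := fun s =>
  `[< forall i j, s i j = s j i >].
Lemma sym2_predP s : s \in sym2_pred <-> forall i j, s i j = s j i.
Proof. by split => [/asboolP|h]; [|exact/asboolP]. Qed.
Lemma sym2_submod_closed : submod_closed sym2_pred.
Proof.
split=> [|a s t /sym2_predP sS /sym2_predP tS]; apply/sym2_predP => // i j.
by rewrite [LHS](_ : _ = a *: s i j + t i j)// sS tS.
Qed.
HB.instance Definition _ :=
  GRing.isSubmodClosed.Build R _ sym2_pred sym2_submod_closed.

Definition sym4_pred : {pred I -> I -> I -> I -> L} := fun D =>
  `[< forall i j k l, D i j k l = D j i k l /\ D i j k l = D k l i j >].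
Lemma sym4_predP D : D \in sym4_pred <->
  forall i j k l, D i j k l = D j i k l /\ D i j k l = D k l i j.
Proof. by split => [/asboolP|h]; [|exact/asboolP]. Qed.
Lemma sym4_submod_closed : submod_closed sym4_pred.
Proof.
split=> [|a s t /sym4_predP sS /sym4_predP tS]; apply/sym4_predP => // i j k l.
have E i' j' k' l' :
  (a *: s + t) i' j' k' l' = a *: s i' j' k' l' + t i' j' k' l' by [].
have [s1 s2] := sS i j k l; have [t1 t2] := tS i j k l.
by split; rewrite !E; [rewrite s1 t1|rewrite s2 t2].
Qed.
HB.instance Definition _ :=
  GRing.isSubmodClosed.Build R _ sym4_pred sym4_submod_closed.
Lemma sym2_comb a (s t : submod sym2_pred) i j : submod_val (a *: s + t) i j =
  a *: submod_val s i j + submod_val t i j.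
Proof. by []. Qed.
End symmetric_tensors.

Section Qspace.
Context {R : realType} {d : nat} (Om : set 'rV[R]_d).
Local Notation L2Om := (L2 (mlebesgue Om)).
Local Notation LinfOm := (Linf (mlebesgue Om)).

Definition Qspace : lmodType R := submod (@sym2_pred R 'I_d L2Om).
Definition Q_comp (s : Qspace) (i j : 'I_d) : L2Om := submod_val s i j.

Lemma Q_compP a (s t : Qspace) i j :
  Q_comp (a *: s + t) i j = a *: Q_comp s i j + Q_comp t i j.
Proof. exact: sym2_comb. Qed.

Lemma Q_ext (s t : Qspace) :
  (forall i j, Q_comp s i j = Q_comp t i j) -> s = t.
Proof.
by move=> st; apply: val_inj; apply/funext => i; apply/funext => j; exact: st.
Qed.

Definition Q_ip (s t : Qspace) : R := \sum_i \sum_j L2_ip (Q_comp s i j) (Q_comp t i j).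
Definition Q_norm (s : Qspace) : R := Num.sqrt (Q_ip s s).

Lemma Q_ipC s t : Q_ip s t = Q_ip t s.
Proof. by apply: eq_bigr => i _; apply: eq_bigr => j _; rewrite L2_ipC. Qed.
Lemma Q_ipP r a s t : Q_ip r (a *: s + t) = a * Q_ip r s + Q_ip r t.
Proof.
rewrite /Q_ip mulr_sumr -big_split; apply: eq_bigr => i _.
rewrite mulr_sumr -big_split; apply: eq_bigr => j _.
by rewrite Q_compP L2_ipP.
Qed.
Lemma Q_ip_ge0 s : 0 <= Q_ip s s.
Proof. by apply: sumr_ge0 => i _; apply: sumr_ge0 => j _; exact: L2_ip_ge0. Qed.

Definition Qinf : lmodType R := submod (@sym4_pred R 'I_d LinfOm).
Definition Qinf_comp (D : Qinf) (i j k l : 'I_d) : LinfOm := submod_val D i j k l.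

Definition Qinf_norm (D : Qinf) : R :=
  \big[Num.max/0]_i \big[Num.max/0]_j \big[Num.max/0]_k \big[Num.max/0]_l
    Linf_norm (Qinf_comp D i j k l).

Lemma Qinf_act_sym (D : Qinf) (s : Qspace) :
  (fun i j => \sum_k \sum_l Linf_act (Qinf_comp D i j k l) (Q_comp s k l)) \in @sym2_pred R _ _.
Proof.
apply/sym2_predP => i j; apply: eq_bigr => k _; apply: eq_bigr => l _.
have /sym4_predP/(_ i j k l)[E _] := submod_valP D.
by rewrite /Qinf_comp E.
Qed.
Definition Qinf_act (D : Qinf) (s : Qspace) : Qspace :=
  Submod (Qinf_act_sym D s).
End Qspace.

Section strain.
Context {R : realType} {d : nat} {Om Gam1 : set 'rV[R]_d}.
Local Notation V := (Vspace Om Gam1).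

Lemma eps_sym (v : V) :
  (fun i j => 2^-1 *: (grad v i j + grad v j i)) \in @sym2_pred R _ _.
Proof. by apply/sym2_predP => i j; rewrite addrC. Qed.
Definition eps (v : V) : Qspace Om := Submod (eps_sym v).

Lemma eps_comp v i j :
  Q_comp (eps v) i j = 2^-1 *: (grad v i j + grad v j i).
Proof. by []. Qed.

Lemma epsP a u v : eps (a *: u + v) = a *: eps u + eps v.
Proof.
apply: Q_ext => i j; rewrite Q_compP !eps_comp !grad_comb.
by rewrite addrACA -[a *: _ + a *: _]scalerDr [LHS]scalerDr !scalerA [_ * a]mulrC.
Qed.

Definition V_ip (u v : V) : R := Q_ip (eps u) (eps v).
Definition V_norm (v : V) : R := Num.sqrt (V_ip v v).
Definition Vdual : lmodType R := dual V_norm.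

Lemma eps_adj_dual (eta : Qspace Om) :
  (fun v => Q_ip eta (eps v)) \in dual_pred V_norm.
Proof.
apply/dual_predP; split=> [a u v|]; first by rewrite epsP Q_ipP.
exists (Q_norm eta) => v.
by apply: sip_CS; [exact: Q_ipC|exact: Q_ip_ge0|exact: Q_ipP].
Qed.
Definition eps_adj (eta : Qspace Om) : Vdual := Submod (eps_adj_dual eta).

Definition Vdual_norm : Vdual -> R := @dual_norm R V V_norm.
End strain.
Arguments Vdual {R d} Om Gam1.

Section problems.
Context {R : realType} {d : nat} {Om Gam1 : set 'rV[R]_d}.
Local Notation V := (Vspace Om Gam1).
Local Notation Q := (Qspace Om).
Local Notation V' := (Vdual Om Gam1).
Variables (T : R) (U : set V) (B : Q -> Q) (Rel : R -> Qinf Om).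
Variables (P : V -> V') (f : R -> V').

Definition monotone_op (A : V -> V') :=
  forall u v, 0 <= pairing (A u - A v) (u - v).

Definition stiffness (u : V) : V' := eps_adj (B (eps u)).

Definition VI_solution (omega : V') (z : V) := U z /\
  forall v, U v -> pairing omega (v - z) <= pairing (stiffness z + P z) (v - z).

(* [F] is the operator sending [omega] to the unique solution of the
   variational inequality with right-hand side [omega]. *)
Definition VI_solver (F : V' -> V) :=
  forall omega z, VI_solution omega z <-> z = F omega.

Definition history (u : R -> V) (t : R) : Q :=
  vint (@Q_norm _ _ Om) 0 t (fun s => Qinf_act (Rel (t - s)) (eps (u s))).

Definition vi_lhs (u : R -> V) (t : R) (v : V) : R :=
  Q_ip (B (eps (u t))) (eps v - eps (u t)) +
  Q_ip (history u t) (eps v - eps (u t)) + pairing (P (u t)) (v - u t).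

Definition problem_P (u : R -> V) := forall t, t \in `[0, T] -> U (u t) /\
  forall v, U v -> pairing (f t) (v - u t) <= vi_lhs u t v.

Definition problem_Q (F : V' -> V) (u : R -> V) := forall t, t \in `[0, T] ->
  u t = F (f t - eps_adj (history u t)).

Definition in_CU (u : R -> V) :=
  in_C (@V_norm _ _ Om Gam1) T u /\ forall t, t \in `[0, T] -> U (u t).

Definition unique_solution (problem : (R -> V) -> Prop) (u : R -> V) :=
  [/\ in_CU u, problem u &
      forall w, in_CU w -> problem w -> forall t, t \in `[0, T] -> w t = u t].

Definition p_approximating (un : nat -> R -> V) :=
  [/\ forall n, in_C (@V_norm _ _ Om Gam1) T (un n),
      forall n t, t \in `[0, T] -> U (un n t) &
      exists e : nat -> R, [/\ forall n, 0 <= e n, e n @[n --> \oo] --> 0 &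
        forall v t n, U v -> t \in `[0, T] ->
          pairing (f t) (v - un n t) <=
          vi_lhs (un n) t v + e n * V_norm (v - un n t)]].

Definition q_approximating (F : V' -> V) (un : nat -> R -> V) :=
  (forall n, in_C (@V_norm _ _ Om Gam1) T (un n)) /\
  exists e : nat -> R, [/\ forall n, 0 <= e n, e n @[n --> \oo] --> 0 &
    forall t n, t \in `[0, T] ->
      V_norm (un n t - F (f t - eps_adj (history (un n) t))) <= e n].

(* Well-posedness of [problem], with solution [u], with respect to the
   approximating sequences [approx]. *)
Definition well_posed (problem : (R -> V) -> Prop)
    (approx : (nat -> R -> V) -> Prop) (u : R -> V) :=
  unique_solution problem u /\
  forall un, approx un -> C_cvg (@V_norm _ _ Om Gam1) T un u.
End problems.

(* Main.v *)
Require Import Defs.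
From HB Require Import structures.
From mathcomp Require Import all_boot all_order all_algebra.
From mathcomp Require Import zify ring lra.
From mathcomp Require Import all_classical all_reals all_analysis.
From mathcomp Require Import ess_sup_inf measurable_realfun.

Set Implicit Arguments.
Unset Strict Implicit.
Unset Printing Implicit Defensive.
Import Order.TTheory GRing.Theory Num.Theory.
Import numFieldNormedType.Exports.
Local Open Scope classical_set_scope.
Local Open Scope ring_scope.

(* Testing the inequality of an approximating curve [u_n] with [u], and that of
   [u] with [u_n] (or with [F] of the right-hand side, for q-approximating
   sequences), coercivity of [B] and monotonicity of [P] bound
   [|u_n(t) - u(t)|_V] by the distance of the history terms at [t] plus a
   multiple of [e_n].  The history distance is at most
   [C * \int_0^t |u_n(s) - u(s)|_V ds], so a Gronwall argument gives uniform
   convergence.  The history integral is a limit of Riemann sums; it exists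
   because the integrand is uniformly continuous and [Q] is complete, which
   is the Riesz-Fischer theorem for L^2. *)

(** The history term couples [u_n(t)] to its whole past, so a comparison at one time does not close
    by itself. The weight [expR (- (lam * t))] closes it in one step: a bound [M * expR (lam * s)]
    on the distance passes through the history integral with a factor [1 / lam], and choosing [lam]
    against [m^-1] and a bound on [Rel] leaves [M <= M / 2 + O(e_n)]. Absorbing [M / 2] requires a
    finite [M], whence the boundedness of continuous curves. The scalar function [|u_n(s) - u(s)|_V]
    is never integrated: Riemann sums are compared directly with sums of the exponential. Since
    [vint] is a choice operator with a default value, every estimate on [history] rests on the
    existence of the integral, over arbitrary tagged partitions. Norms being plain functions on
    [lmodType]s, the analysis is phrased for seminorms. *)

Section seminorms.
Context {R : realType} {X : lmodType R}.

Definition seminorm (N : X -> R) :=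
  (forall x y, N (x + y) <= N x + N y) /\ forall a x, N (a *: x) = `|a| * N x.

(* Only the existence of limits: [N] need not separate points. *)
Definition complete_wrt (N : X -> R) := forall u : nat -> X,
  (forall e, 0 < e -> exists n0, forall m n, (n0 <= m)%N -> (n0 <= n)%N ->
     N (u m - u n) < e) ->
  exists l, forall e, 0 < e -> exists n0, forall n, (n0 <= n)%N -> N (u n - l) < e.

(** For [a != 0] the reverse bound is the hypothesis for [a^-1] at the point [a *: x]; for [a = 0]
    it is [0 <= N 0], a consequence of subadditivity. *)
Lemma le_seminorm (N : X -> R) : (forall x y, N (x + y) <= N x + N y) ->
  (forall a x, N (a *: x) <= `|a| * N x) -> seminorm N.
Proof.
move=> ND NZ; split=> // a x; apply/eqP; rewrite eq_le NZ/=.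
have [->|a0] := eqVneq a 0.
  by rewrite normr0 mul0r scale0r -(lerD2l (N 0)) addr0 -[in leLHS](addr0 0) ND.
rewrite -ler_pdivlMl ?normr_gt0// -normfV.
by apply: le_trans (NZ _ _); rewrite scalerA mulVf// scale1r.
Qed.

Variable N : X -> R.
Hypothesis NS : seminorm N.

Lemma seminorm0 : N 0 = 0.
Proof. by rewrite -(scale0r 0) NS.2 normr0 mul0r. Qed.

Lemma seminormN x : N (- x) = N x.
Proof. by rewrite -scaleN1r NS.2 normrN1 mul1r. Qed.

Lemma seminormBC x y : N (x - y) = N (y - x).
Proof. by rewrite -seminormN opprB. Qed.

Lemma seminorm_ge0 x : 0 <= N x.
Proof.
have := NS.1 x (- x); rewrite subrr seminorm0 seminormN -mulr2n.
by rewrite pmulrn_lge0.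
Qed.

Lemma seminormB_trans y x z : N (x - z) <= N (x - y) + N (y - z).
Proof. by apply: le_trans (NS.1 _ _); rewrite addrA subrK. Qed.

Lemma seminorm_sum (I : Type) (r : seq I) (p : pred I) (F : I -> X) :
  N (\sum_(i <- r | p i) F i) <= \sum_(i <- r | p i) N (F i).
Proof.
elim/big_rec2 : _ => [|i y x _ yx]; first by rewrite seminorm0.
by rewrite (le_trans (NS.1 _ _))// lerD2l.
Qed.

End seminorms.

(** * Riemann sums and the vector-valued integral *)

Section riemann.
Context {R : realType} {X : lmodType R}.

(** The condition that [is_vint] puts on nodes and tags; nodes may repeat. *)
Definition tagged_partition (a b delta : R) (k : nat) (x xi : nat -> R) :=
  [/\ x 0%N = a, x k = b & forall i, (i < k)%N ->
      x i <= xi i <= x i.+1 /\ x i.+1 - x i < delta].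

Definition riemann_sum (g : R -> X) (k : nat) (x xi : nat -> R) : X :=
  \sum_(i < k) (x i.+1 - x i) *: g (xi i).

Lemma tagged_partition_bounds a b delta k x xi : tagged_partition a b delta k x xi ->
  forall i, (i <= k)%N -> a <= x i <= b.
Proof.
move=> [x0 xk xP] i ik; apply/andP; split.
  elim: i ik => [|i IH] ik; first by rewrite x0.
  by have := IH (ltnW ik); have [/andP[]] := xP _ ik; lra.
(* Induction on the distance to the last node; past [k] the truncated subtraction just repeats index
   [0]. *)
rewrite -(subKn ik); elim: (k - i)%N => [|j IH]; first by rewrite subn0 xk.
have [jk|kj] := ltnP j k; last by rewrite (eqP (_ : (k - j.+1 == k - j)%N)); lia.
have := IH; rewrite -(subnSK jk); have lt : (k - j.+1 < k)%N by lia.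
by have [/andP[]] := xP _ lt; lra.
Qed.

Lemma tagged_partition_tag a b delta k x xi : tagged_partition a b delta k x xi ->
  forall i, (i < k)%N -> a <= xi i <= b.
Proof.
move=> P i ik; have := tagged_partition_bounds P (ltnW ik).
have := tagged_partition_bounds P ik; case: P => _ _ /(_ _ ik)[].
by move=> /andP[? ?] _ /andP[? ?] /andP[? ?]; apply/andP; split; lra.
Qed.

Ltac minmax_cases := rewrite ?minEle ?maxEle; repeat match goal with
  |- context [if (?a <= ?b)%R then _ else _] =>
    lazymatch constr:((a, b)) with
    | context [if _ then _ else _] => fail
    | _ => case: (lerP a b) => ?
    end
  end.

Definition clamp (l r y : R) := Num.max l (Num.min r y).

(* The length of the intersection of [l,r] and [y,z], as a difference that
   telescopes in either interval. *)
Lemma clampC (l r y z : R) : l <= r -> y <= z ->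
  clamp l r z - clamp l r y = clamp y z r - clamp y z l.
Proof. by rewrite /clamp => *; minmax_cases; lra. Qed.

(** Two cells that meet have a common point, less than [delta] away from either tag; cells that do
    not meet have overlap zero. *)
Lemma clamp_overlap (l r y z xi eta delta : R) : l <= xi <= r -> y <= eta <= z ->
  r - l < delta -> z - y < delta ->
  clamp l r z - clamp l r y = 0 \/
  0 <= clamp l r z - clamp l r y /\ `|xi - eta| < delta *+ 2.
Proof.
move=> /andP[? ?] /andP[? ?] ? ?; rewrite /clamp ltr_norml mulr2n.
by minmax_cases; first [left; lra|right; split; [lra|apply/andP; split; lra]].
Qed.

Lemma clamp_telescope (l r a b : R) k (y : nat -> R) : y 0%N = a -> y k = b ->
  a <= l -> l <= r -> r <= b -> \sum_(j < k) (clamp l r (y j.+1) - clamp l r (y j)) = r - l.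
Proof.
move=> y0 yk al lr rb.
rewrite -(big_mkord xpredT (fun j => clamp l r (y j.+1) - clamp l r (y j))).
rewrite telescope_sumr// y0 yk /clamp.
by minmax_cases; lra.
Qed.

Variable N : X -> R.
Hypothesis NS : seminorm N.

(** Instead of building a common refinement, both sums are spread over all pairs of cells, weighted
    by the overlap lengths [ov i j]. A pair of nonzero weight has tags closer than [delta *+ 2], and
    the weights add up to [b - a]. *)
Lemma riemann_sum_close (g : R -> X) a b delta w k x xi k' y eta :
  (forall s s', a <= s <= b -> a <= s' <= b -> `|s - s'| < delta *+ 2 ->
     N (g s - g s') <= w) ->
  tagged_partition a b delta k x xi -> tagged_partition a b delta k' y eta ->
  N (riemann_sum g k x xi - riemann_sum g k' y eta) <= (b - a) * w.
Proof.
move=> gw Px Py; have [x0 xk xP] := Px; have [y0 yk yP] := Py.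
pose ov i j := clamp (x i) (x i.+1) (y j.+1) - clamp (x i) (x i.+1) (y j).
have lex i : (i < k)%N -> x i <= x i.+1 by move=> /xP[/andP[? ?] _]; lra.
have ley j : (j < k')%N -> y j <= y j.+1 by move=> /yP[/andP[? ?] _]; lra.
have ovx i : (i < k)%N -> \sum_(j < k') ov i j = x i.+1 - x i.
  move=> ik; apply: (clamp_telescope y0 yk _ (lex _ ik)).
    by have /andP[] := tagged_partition_bounds Px (ltnW ik).
  by have /andP[] := tagged_partition_bounds Px ik.
(* [ov] clamps to a cell of [x]; [clampC] re-expresses it by clamping to a cell of [y], which is the
   form that telescopes in [i]. *)
have ovy j : (j < k')%N -> \sum_(i < k) ov i j = y j.+1 - y j.
  move=> jk; rewrite (eq_bigr (fun i : 'I_k => clamp (y j) (y j.+1) (x i.+1) -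
    clamp (y j) (y j.+1) (x i))); last first.
    by move=> i _; apply: clampC; [exact: lex|exact: ley].
  apply: (clamp_telescope x0 xk _ (ley _ jk)).
    by have /andP[] := tagged_partition_bounds Py (ltnW jk).
  by have /andP[] := tagged_partition_bounds Py jk.
have Sx : riemann_sum g k x xi = \sum_(i < k) \sum_(j < k') ov i j *: g (xi i).
  by apply: eq_bigr => i _; rewrite -scaler_suml ovx.
have Sy : riemann_sum g k' y eta = \sum_(i < k) \sum_(j < k') ov i j *: g (eta j).
  by rewrite exchange_big; apply: eq_bigr => j _; rewrite -scaler_suml ovy.
have Eab : b - a = \sum_(i < k) \sum_(j < k') ov i j.
  rewrite (eq_bigr (fun i : 'I_k => x i.+1 - x i)); last by move=> i _; exact: ovx.
  rewrite -(big_mkord xpredT (fun i => x i.+1 - x i)) telescope_sumr// xk x0.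
  by [].
rewrite Sx Sy -sumrB Eab mulr_suml (le_trans (seminorm_sum NS _ _ _))// ler_sum// => i _.
rewrite -sumrB mulr_suml (le_trans (seminorm_sum NS _ _ _))// ler_sum// => j _.
rewrite -scalerBr NS.2.
have [xi1 xi2] := xP i (ltn_ord i); have [yj1 yj2] := yP j (ltn_ord j).
have [E|[ge0 lt]] := clamp_overlap xi1 yj1 xi2 yj2.
  by rewrite /ov E normr0 !mul0r.
rewrite ger0_norm// ler_wpM2l// gw//.
  exact: (tagged_partition_tag Px).
exact: (tagged_partition_tag Py).
Qed.

Lemma uniform_partition (a b delta : R) k : a <= b -> (b - a) / k.+1%:R < delta ->
  tagged_partition a b delta k.+1 (fun i => a + i%:R * ((b - a) / k.+1%:R))
    (fun i => a + i%:R * ((b - a) / k.+1%:R)).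
Proof.
move=> ab; have : 0 <= (b - a) / k.+1%:R by rewrite divr_ge0// subr_ge0.
have : (b - a) / k.+1%:R * k.+1%:R = b - a by rewrite divfK// pnatr_eq0.
move: (_ / _) => h hk h0 hd.
split; first by rewrite mul0r addr0.
  by rewrite mulrC hk; lra.
by move=> i _ /=; rewrite -[i.+1%:R]natr1 [(_ + 1) * _]mulrDl mul1r; split; [apply/andP; split|]; lra.
Qed.

Lemma mesh_small (a b delta : R) : 0 < delta ->
  exists n0, forall n, (n0 <= n)%N -> (b - a) / n.+1%:R < delta.
Proof.
move=> d0; have [r|r] := leP (b - a) 0.
  by exists 0%N => n _; rewrite (le_lt_trans _ d0)// mulr_le0_ge0// invr_ge0.
exists (Num.trunc ((b - a) / delta)).+1 => n nn.
rewrite ltr_pdivrMr// mulrC -ltr_pdivrMr//.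
rewrite (lt_le_trans (truncnS_gt _))//.
by rewrite ler_nat; apply: (leq_trans nn).
Qed.

(** Sums over uniform partitions form a Cauchy sequence, which yields a candidate limit; any fine
    tagged sum is close to a fine uniform one, hence to the candidate. *)
Lemma is_vint_exists (g : R -> X) a b : complete_wrt N -> a <= b ->
  (forall e, 0 < e -> exists2 delta, 0 < delta & forall s s', a <= s <= b ->
     a <= s' <= b -> `|s - s'| < delta -> N (g s - g s') < e) ->
  exists l, is_vint N a b g l.
Proof.
move=> Ncomp ab gu.
have close e : 0 < e -> exists2 delta, 0 < delta & forall k x xi k' y eta,
    tagged_partition a b delta k x xi -> tagged_partition a b delta k' y eta ->
    N (riemann_sum g k x xi - riemann_sum g k' y eta) < e.
  (* The [+ 1] covers [a = b] and makes the final bound by [e] strict. *)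
  move=> e0; have e'0 : 0 < e / (b - a + 1) by rewrite divr_gt0//; lra.
  have [delta d0 gd] := gu _ e'0.
  (* Tags of overlapping cells may be up to two meshes apart. *)
  exists (delta / 2); first by rewrite divr_gt0.
  move=> k x xi k' y eta Px Py.
  apply: (@le_lt_trans _ _ ((b - a) * (e / (b - a + 1)))).
    apply: riemann_sum_close Px Py => s s' sab s'ab ss'.
    by apply/ltW/gd => //; rewrite (lt_le_trans ss')//; lra.
  by rewrite mulrA ltr_pdivrMr; [nra|lra].
pose pt n i := a + i%:R * ((b - a) / n.+1%:R).
pose v n := riemann_sum g n.+1 (pt n) (pt n).
have [e e0|l vl] := Ncomp v.
  have [delta d0 dP] := close e e0.
  have [n0 n0P] := mesh_small a b d0.
  by exists n0 => m n mn nn; apply: dP; apply: uniform_partition => //; exact: n0P.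
exists l => e e0; have e2 : 0 < e / 2 by rewrite divr_gt0.
have [delta d0 dP] := close _ e2.
have [n0 n0P] := mesh_small a b d0.
have [n1 n1P] := vl _ e2.
exists delta => // k x xi xa xb xP.
pose n := maxn n0 n1.
have Pn : tagged_partition a b delta n.+1 (pt n) (pt n).
  by apply: uniform_partition => //; apply: n0P; exact: leq_maxl.
have h1 : N (riemann_sum g k x xi - v n) < e / 2 by exact: dP.
have h2 := n1P n (leq_maxr _ _).
by have := seminormB_trans NS (v n) (riemann_sum g k x xi) l; rewrite /riemann_sum in h1 *; lra.
Qed.

(** [vint] is an [xget] with default [0]: it carries information only once some integral is known to
    exist. *)
Lemma vintP (g : R -> X) a b : (exists l, is_vint N a b g l) ->
  is_vint N a b g (vint N a b g).
Proof. by move=> [l gl]; apply: (xgetPex 0); exists l. Qed.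

(* Left tags turn the exponential bound into a lower sum of [expR (lam * s)],
   which telescopes. *)
Lemma vint_sub_expR (g h : R -> X) (lg lh : X) t lam M : 0 <= t -> 0 < lam -> 0 <= M ->
  is_vint N 0 t g lg -> is_vint N 0 t h lh ->
  (forall s, 0 <= s <= t -> N (g s - h s) <= M * expR (lam * s)) ->
  N (lg - lh) <= M / lam * expR (lam * t).
Proof.
move=> t0 l0 M0 gl hl gh; apply/ler_addgt0Pr => e e0.
have e2 : 0 < e / 2 by rewrite divr_gt0.
have [d1 d10 d1P] := gl _ e2; have [d2 d20 d2P] := hl _ e2.
have d0 : 0 < Num.min d1 d2 by rewrite lt_min d10.
have [n0 n0P] := mesh_small 0 t d0.
have Px := uniform_partition t0 (n0P _ (leqnn _)).
set x := (fun i : nat => 0 + i%:R * _) in Px; set k := n0.+1 in Px.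
have xb := tagged_partition_bounds Px.
have [x0 xk xP] := Px.
have h1 : N (riemann_sum g k x x - lg) < e / 2.
  apply: d1P => // i ik; have [? xd] := xP _ ik; split => //.
  by rewrite (lt_le_trans xd)// ge_min lexx.
have h2 : N (riemann_sum h k x x - lh) < e / 2.
  apply: d2P => // i ik; have [? xd] := xP _ ik; split => //.
  by rewrite (lt_le_trans xd)// ge_min lexx orbT.
have h3 : N (riemann_sum g k x x - riemann_sum h k x x) <= M / lam * expR (lam * t).
  rewrite /riemann_sum -sumrB (le_trans (seminorm_sum NS _ _ _))//.
  apply: (@le_trans _ _ (\sum_(i < k) (M / lam * expR (lam * x i.+1) - M / lam * expR (lam * x i)))).
    apply: ler_sum => i _; have [/andP[_ xx] _] := xP i (ltn_ord i).
    rewrite -scalerBr NS.2 ger0_norm ?subr_ge0//.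
    have := gh _ (xb i (ltnW (ltn_ord i))).
    (* This is [1 + y <= expR y] at [y = lam * (x i.+1 - x i)], multiplied by [expR (lam * x i)]. *)
    have D : lam * (x i.+1 - x i) * expR (lam * x i) <= expR (lam * x i.+1) - expR (lam * x i).
      have := expR_ge1Dx (lam * (x i.+1 - x i)); have := expR_gt0 (lam * x i).
      rewrite [in X in _ -> _ -> _ <= X - _](_ : lam * x i.+1 = lam * (x i.+1 - x i) + lam * x i); last by ring.
      by rewrite expRD; nra.
    move=> ghi; apply: (@le_trans _ _ ((x i.+1 - x i) * (M * expR (lam * x i)))).
      by rewrite ler_wpM2l// subr_ge0.
    rewrite -mulrBr -mulrA; apply: (@le_trans _ _ (M * (lam^-1 * (lam * (x i.+1 - x i) * expR (lam * x i))))).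
      by rewrite le_eqVlt; apply/orP; left; apply/eqP; field; rewrite gt_eqF.
    by rewrite ler_wpM2l// ler_wpM2l// invr_ge0 ltW.
  rewrite -(big_mkord xpredT (fun i => M / lam * expR (lam * x i.+1) - M / lam * expR (lam * x i))).
  rewrite telescope_sumr// xk x0 lerBlDr lerDl mulr_ge0 ?expR_ge0//.
  by rewrite divr_ge0// ltW.
have t1 := seminormB_trans NS (riemann_sum g k x x) lg lh.
have t2 := seminormB_trans NS (riemann_sum h k x x) (riemann_sum g k x x) lh.
by rewrite (seminormBC NS lg (riemann_sum _ _ _ _)) in t1; lra.
Qed.

End riemann.

(** * Continuous curves on a segment *)

Section continuous_curves.
Context {R : realType} {X : lmodType R}.
Variables (N : X -> R) (T : R).
Hypothesis NS : seminorm N.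

Lemma in_C_near (u : R -> X) : in_C N T u -> forall t : R, t \in `[0, T] ->
  forall e : R, 0 < e -> exists2 delta : R, 0 < delta &
    forall s : R, s \in `[0, T] -> `|t - s| < delta -> N (u s - u t) < e.
Proof.
move=> uC t tT e e0; have := uC t tT.
move=> /cvgr0Pnorm_lt/(_ e e0)/nbhs_ballP[delta /= d0 dP].
exists delta => // s sT st; have := dP s st sT.
by rewrite ger0_norm// (seminorm_ge0 NS).
Qed.

(** Heine's theorem, with compactness in the form [near_covering]: continuity at [t] handles all
    [t'] near [t] and all small [delta], and the covering property makes the smallness of [delta]
    uniform in [t]. *)
Lemma in_C_unif (u : R -> X) : in_C N T u -> forall e : R, 0 < e ->
  exists2 delta : R, 0 < delta & forall s t : R, s \in `[0, T] -> t \in `[0, T] ->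
    `|s - t| < delta -> N (u s - u t) < e.
Proof.
move=> uC e e0.
have cov : near_covering `[0, T]%classic.
  exact/compact_near_coveringP/segment_compact.
have [|delta /= d0 dP] := cov _ (0 : R)^'+ (fun delta t => forall s : R, t \in `[0, T] -> s \in `[0, T] ->
    `|s - t| < delta -> N (u s - u t) < e).
  move=> /= t tT; have e2 : 0 < e / 2 by rewrite divr_gt0.
  have [delta d0 dP] := in_C_near uC tT e2.
  have d2 : 0 < delta / 2 by rewrite divr_gt0.
  have key (t' delta' s : R) : `|t - t'| < delta / 2 -> delta' < delta / 2 ->
      t' \in `[0, T] -> s \in `[0, T] -> `|s - t'| < delta' -> N (u s - u t') < e.
    move=> tt' dd t'T sT st'.
    have h1 : N (u t' - u t) < e / 2 by apply: dP => //; lra.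
    have h2 : N (u s - u t) < e / 2.
      by apply: dP => //; rewrite (le_lt_trans (ler_distD t' _ _))// (distrC t' s); lra.
    have := seminormB_trans NS (u t) (u s) (u t').
    by rewrite (seminormBC NS (u t) (u t')); lra.
  near=> t' delta' => s.
  have tt' : `|t - t'| < delta / 2 by near: t'; exact: nbhsx_ballx.
  have dd : delta' < delta / 2 by near: delta'; exact: nbhs_right_lt.
  by move=> /= t'T sT; apply: (key t' delta' s).
(* Here [delta] is the radius of a right neighbourhood of [0]; [delta / 2] is an element of it. *)
exists (delta / 2); first by rewrite divr_gt0.
move=> s t sT tT st; apply: (dP (delta / 2)) => //=.
- by rewrite sub0r normrN gtr0_norm ?divr_gt0//; lra.
- by rewrite divr_gt0.
Unshelve. all: by end_near. Qed.

(** The same covering argument along [pinfty_nbhs]: near [t], every [M] above [N (u t) + 1] is a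
    bound. *)
Lemma in_C_bounded (u : R -> X) : in_C N T u ->
  exists M, 0 <= M /\ forall t, t \in `[0, T] -> N (u t) <= M.
Proof.
move=> uC.
have cov : near_covering `[0, T]%classic.
  exact/compact_near_coveringP/segment_compact.
have [|M [_ MP]] := cov _ (pinfty_nbhs R) (fun M t => t \in `[0, T] -> N (u t) <= M).
  move=> t tT; have [delta d0 dP] := in_C_near uC tT ltr01.
  have key (t' M : R) : `|t - t'| < delta -> N (u t) + 1 <= M ->
      t' \in `[0, T] -> N (u t') <= M.
    move=> tt' tM t'T; have := dP _ t'T tt'.
    by have := NS.1 (u t' - u t) (u t); rewrite subrK; lra.
  near=> t' M.
  have tt' : `|t - t'| < delta by near: t'; exact: nbhsx_ballx.
  have tM : N (u t) + 1 <= M by near: M; apply: nbhs_pinfty_ge; exact: num_real.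
  by move=> /=; apply: (key t' M).
(* [MP] speaks of reals strictly above [M], hence [M + 1]; the maximum ensures the sign. *)
exists (Num.max 0 (M + 1)); split; first by rewrite le_max; apply/orP; left.
move=> t tT; rewrite le_max; apply/orP; right; apply: (MP (M + 1)) => //.
by rewrite ltrDl.
Unshelve. all: by end_near. Qed.

(** [0 <= T] makes the set of values nonempty and [e n] bounds it, so the real [sup] in [C_norm] is
    a genuine one, squeezed between [0] and [e n]. *)
Lemma C_cvgW (un : nat -> R -> X) (u : R -> X) (e : nat -> R) : 0 <= T ->
  e n @[n --> \oo] --> 0 ->
  (forall n t, t \in `[0, T] -> N (un n t - u t) <= e n) -> C_cvg N T un u.
Proof.
move=> T0 e0 h; apply: (squeeze_cvgr _ (cvg_cst 0) e0).
apply: nearW => n.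
rewrite /C_norm; set S := (X in sup X).
have S0 : S (N (un n 0 - u 0)) by exists 0 => //=; rewrite in_itv/= lexx.
have Sub : ubound S (e n) by move=> _ [t tT <-]; exact: h.
apply/andP; split; last first.
  by apply: ge_sup => //; exists (N (un n 0 - u 0)).
apply: (le_trans (seminorm_ge0 NS (un n 0 - u 0))).
by apply: ub_le_sup => //; exists (e n).
Qed.

End continuous_curves.

(** * Semi-inner products; estimates in L^infinity and L^2 *)

Lemma sip_seminorm {R : realType} (X : lmodType R) (b : X -> X -> R)
  (bC : forall x y, b x y = b y x) (b_ge0 : forall x, 0 <= b x x)
  (bP : forall x a y z, b x (a *: y + z) = a * b x y + b x z) :
  seminorm (fun x => Num.sqrt (b x x)).
Proof.
have bD x y z : b x (y + z) = b x y + b x z by rewrite -[y in LHS]scale1r bP mul1r.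
have b0 x : b x 0 = 0.
  by apply: (addrI (b x 0)); rewrite -bD !addr0.
have bZ x a y : b x (a *: y) = a * b x y by rewrite -[a *: y]addr0 bP b0 addr0.
split=> [x y|a x].
  rewrite -[leRHS]ger0_norm ?addr_ge0 ?sqrtr_ge0// -sqrtr_sqr ler_wsqrtr//.
  have := sip_CS bC b_ge0 bP x y; have := ler_norm (b x y).
  rewrite sqrrD !sqr_sqrtr// bD (bC (x + y) x) (bC (x + y) y) !bD (bC y x).
  move: (Num.sqrt _ * _) => s ? ?; rewrite mulr2n; lra.
by rewrite bZ bC bZ mulrA -expr2 sqrtrM ?sqr_ge0// sqrtr_sqr.
Qed.

Section Lp_facts.
Context d (T : measurableType d) (R : realType).
Variable mu : {measure set T -> \bar R}.

Local Notation Linf := (Lp mu (leey 1%E)).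
Local Notation L2 := (Lp mu (lee1n 2)).

Lemma Linf_norm_ae (a : Linf) : {ae mu, forall x, `|Lp_fun a x| <= Linf_norm a}.
Proof.
(* At exponent infinity [Lnorm] is the essential supremum only if [mu setT] is positive; on a null
   space everything holds almost everywhere. *)
have [mu0|mu0] := eqVneq (mu setT) 0%E.
  by exists setT; split.
have := Lfunction_finite (leey 1%E) (Lp_repr a); rewrite /finite_norm => fin.
have finN : ('N[mu]_+oo[EFin \o Lp_fun a])%E \is a fin_num.
  by rewrite ge0_fin_numE// Lnorm_ge0.
have : (ess_sup mu (abse \o (EFin \o Lp_fun a)) <= (Linf_norm a)%:E)%E.
  by rewrite fineK// [in leRHS]unlock /Lnorm lt0e mu0 measure_ge0.
by move=> /ess_supP; apply: filterS => x /=; rewrite lee_fin.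
Qed.

Lemma Linf_norm_le (a : Linf) M : 0 <= M ->
  {ae mu, forall x, `|Lp_fun a x| <= M} -> Linf_norm a <= M.
Proof.
move=> M0 aM; have h : ('N[mu]_+oo[EFin \o Lp_fun a] <= M%:E)%E.
  rewrite unlock /Lnorm; case: ifPn => // _.
  by apply/ess_supP; apply: filterS aM => x /=; rewrite lee_fin.
rewrite -lee_fin fineK//.
by rewrite ge0_fin_numE ?Lnorm_ge0// (le_lt_trans h)// ltry.
Qed.

Lemma Linf_norm_ge0 (a : Linf) : 0 <= Linf_norm a.
Proof. by rewrite fine_ge0// Lnorm_ge0. Qed.

Lemma Lp_ae_scale p (p1 : (1 <= p)%E) a (f : Lp mu p1) :
  {ae mu, forall x, Lp_fun (a *: f) x = a * Lp_fun f x}.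
Proof.
apply: filterS2 (Lp_ae_comb a f 0) (Lp_ae0 mu p1) => x.
by rewrite addr0 => -> ->; rewrite addr0.
Qed.

Lemma Linf_norm_seminorm : seminorm (@Linf_norm _ _ _ mu).
Proof.
apply: le_seminorm => [a b|c a].
  apply: Linf_norm_le; first by rewrite addr_ge0 ?Linf_norm_ge0.
  apply: filterS3 (Lp_ae_comb 1 a b) (Linf_norm_ae a) (Linf_norm_ae b) => x.
  by rewrite scale1r mul1r => -> ax bx; rewrite (le_trans (ler_normD _ _))// lerD.
apply: Linf_norm_le; first by rewrite mulr_ge0 ?Linf_norm_ge0.
apply: filterS2 (Lp_ae_scale c a) (Linf_norm_ae a) => x -> ax.
by rewrite normrM ler_wpM2l.
Qed.

Definition L2_norm (f : L2) : R := Num.sqrt (L2_ip f f).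

Lemma L2_norm_seminorm : seminorm L2_norm.
Proof.
by apply: sip_seminorm; [exact: L2_ipC|exact: L2_ip_ge0|exact: L2_ipP].
Qed.

Lemma measurable_sqr_EFin (f : T -> R) : measurable_fun setT f ->
  measurable_fun setT (fun x => (f x ^+ 2)%:E).
Proof. by move=> mf; apply/measurable_EFinP; exact: measurable_funX. Qed.

Lemma L2_ipE (f : LfunType mu (lee1n 2)) :
  ((L2_ip (Lp_class f) (Lp_class f))%:E = \int[mu]_x (f x ^+ 2)%:E)%E.
Proof.
rewrite L2_ip_class /Rintegral fineK//.
exact: integrable_fin_num (L2_integrableM f f).
Qed.

(** Passes from the real-valued inner product to an extended-real integral of any measurable
    representative, the form to which the convergence theorems apply. *)
Lemma L2_ip_integral (f : L2) (g : T -> R) : measurable_fun setT g ->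
  {ae mu, forall x, Lp_fun f x = g x} ->
  ((L2_ip f f)%:E = \int[mu]_x (g x ^+ 2)%:E)%E.
Proof.
move=> mg fg; rewrite -[in LHS](Lp_reprK f) L2_ipE; apply: ae_eq_integral => //.
- by apply: measurable_sqr_EFin; exact: Lp_fun_measurable.
- exact: measurable_sqr_EFin.
- by apply: filterS fg => x fx _; rewrite -fx.
Qed.

Lemma L2_norm_le (f g : L2) c : 0 <= c ->
  {ae mu, forall x, `|Lp_fun f x| <= c * `|Lp_fun g x|} ->
  L2_norm f <= c * L2_norm g.
Proof.
move=> c0 fg; rewrite /L2_norm -[c in leRHS]ger0_norm// -sqrtr_sqr -sqrtrM ?sqr_ge0//.
rewrite ler_wsqrtr// -lee_fin EFinM.
rewrite (@L2_ip_integral f (Lp_fun f)); [|exact: Lp_fun_measurable|exact/nearW].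
rewrite (@L2_ip_integral g (Lp_fun g)); [|exact: Lp_fun_measurable|exact/nearW].
have mf := measurable_sqr_EFin (Lp_fun_measurable f).
have mg := measurable_sqr_EFin (Lp_fun_measurable g).
rewrite -ge0_integralZl//; last 2 first.
- by move=> x _; rewrite lee_fin sqr_ge0.
- by rewrite lee_fin sqr_ge0.
apply: ae_ge0_le_integral => //.
- by move=> x _; rewrite lee_fin sqr_ge0.
- by move=> x _; rewrite -EFinM lee_fin mulr_ge0 ?sqr_ge0.
- exact: measurable_funeM.
- apply: filterS fg => x fx _; rewrite -EFinM lee_fin -exprMn -(real_normK (num_real (Lp_fun f x))).
  rewrite -(real_normK (num_real (c * Lp_fun g x))) normrM (ger0_norm c0).
  by rewrite ler_pXn2r// ?nnegrE// mulr_ge0.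
Qed.

Lemma Linf_act_ae (a : Linf) (f : L2) :
  {ae mu, forall x, Lp_fun (Linf_act a f) x = Lp_fun a x * Lp_fun f x}.
Proof.
have := Lp_class_ae (Lfun_Sub (lee1n 2) (LfunM_Linf_L2 (Lp_repr a) (Lp_repr f))).
by apply: filterS => x; rewrite Lfun_valP.
Qed.

Lemma Linf_act_norm (a : Linf) (f : L2) :
  L2_norm (Linf_act a f) <= Linf_norm a * L2_norm f.
Proof.
apply: L2_norm_le; first exact: Linf_norm_ge0.
apply: filterS2 (Linf_act_ae a f) (Linf_norm_ae a) => x -> ax.
by rewrite normrM ler_wpM2r.
Qed.

Lemma Lp_aeB p (p1 : (1 <= p)%E) (f g : Lp mu p1) :
  {ae mu, forall x, Lp_fun (f - g) x = Lp_fun f x - Lp_fun g x}.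
Proof.
have := Lp_ae_comb (-1) g f; apply: filterS => x.
by rewrite scaleN1r addrC => ->; rewrite mulN1r addrC.
Qed.

Lemma Linf_actB (a b : Linf) (f g : L2) :
  Linf_act a f - Linf_act b g = Linf_act (a - b) f + Linf_act b (f - g).
Proof.
have L : {ae mu, forall x, Lp_fun (Linf_act a f - Linf_act b g) x =
    Lp_fun a x * Lp_fun f x - Lp_fun b x * Lp_fun g x}.
  apply: filterS3 (Lp_aeB (Linf_act a f) (Linf_act b g)) (Linf_act_ae a f)
    (Linf_act_ae b g) => x -> -> -> //.
have L1 : {ae mu, forall x, Lp_fun (Linf_act (a - b) f) x =
    (Lp_fun a x - Lp_fun b x) * Lp_fun f x}.
  by apply: filterS2 (Linf_act_ae (a - b) f) (Lp_aeB a b) => x -> ->.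
have L2 : {ae mu, forall x, Lp_fun (Linf_act b (f - g)) x =
    Lp_fun b x * (Lp_fun f x - Lp_fun g x)}.
  by apply: filterS2 (Linf_act_ae b (f - g)) (Lp_aeB f g) => x -> ->.
have L3 : {ae mu, forall x, Lp_fun (Linf_act (a - b) f + Linf_act b (f - g)) x =
    Lp_fun a x * Lp_fun f x - Lp_fun b x * Lp_fun g x}.
  apply: filterS3 (Lp_ae_comb 1 (Linf_act (a - b) f) (Linf_act b (f - g))) L1 L2 => x.
  by rewrite scale1r mul1r => -> -> ->; ring.
rewrite -[LHS]Lp_reprK -[RHS]Lp_reprK; apply/Lp_classP.
by apply: filterS2 L L3 => x Lx L3x; rewrite [LHS]Lx -[LHS]L3x.
Qed.

End Lp_facts.

(** * Completeness of L^2 *)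

Lemma sum_half_pow {R : realType} n : \sum_(k < n) (2 ^+ k)^-1 = 2 - 2 / 2 ^+ n :> R.
Proof.
elim: n => [|n IH]; first by rewrite big_ord0 expr0 divr1 subrr.
by rewrite big_ord_recr /= IH exprS; field; rewrite expf_neq0.
Qed.

Section L2_complete.
Context d (T : measurableType d) (R : realType).
Variable mu : {measure set T -> \bar R}.
Local Notation L2 := (Lp mu (lee1n 2)).

(* By AM-GM, [2 |a| <= (2 ^+ k)^-1 + 2 ^+ k * a ^+ 2]. *)
Lemma cvg_weighted_increments (w : nat -> R) M :
  (forall n, \sum_(k < n) 2 ^+ k * (w k.+1 - w k) ^+ 2 <= M) -> cvgn w.
Proof.
move=> wM; pose dw k := w k.+1 - w k.
have bnd n : \sum_(k < n) `|dw k| <= 1 + M / 2.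
  apply: (@le_trans _ _ (\sum_(k < n) ((2 ^+ k)^-1 / 2 + 2 ^+ k * dw k ^+ 2 / 2))).
    apply: ler_sum => k _; have p0 : 0 < 2 ^+ k :> R by rewrite exprn_gt0.
    have pE : (2 ^+ k)^-1 * 2 ^+ k = 1 :> R by rewrite mulVf// gt_eqF.
    have q0 : 0 < (2 ^+ k)^-1 :> R by rewrite invr_gt0.
    move: (2 ^+ k) (2 ^+ k)^-1 p0 q0 pE => p q p0 q0 pq.
    rewrite -(real_normK (num_real (dw k))); move: `|dw k| => z.
    have : 0 <= q * (1 - p * z) ^+ 2 by rewrite mulr_ge0 ?sqr_ge0// ltW.
    have -> : q * (1 - p * z) ^+ 2 = q - 2 * (q * p) * z + (q * p) * p * z ^+ 2 by ring.
    by rewrite pq; lra.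
  rewrite big_split/= -!mulr_suml sum_half_pow.
  have := wM n; have : 0 <= 2 / 2 ^+ n :> R by rewrite divr_ge0// exprn_ge0.
  by rewrite /dw; move: (2 / 2 ^+ n) => z; lra.
have cs : cvgn (series dw).
  apply: normed_cvg; apply: nondecreasing_is_cvgn.
    by apply/nondecreasing_series => k _ _; exact: normr_ge0.
  exists (1 + M / 2) => _ [n _ <-]; rewrite /= seriesEord.
  exact: bnd.
have -> : w = (fun n => w 0%N + series dw n).
  by apply/funext => n; rewrite seriesEnat /= telescope_sumr// addrC subrK.
by apply: is_cvgD => //; exact: is_cvg_cst.
Qed.

(** The series of the [2 ^+ k * (v k.+1 - v k) ^+ 2] has integral at most the sum of
    [2 ^+ k * (2 ^+ k)^-1 ^+ 2], that is at most 2, so it is finite almost everywhere. Weighted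
    squares let the L^2 bounds be used directly, without an L^1 bound on the increments. *)
Lemma L2_ae_cvg (v : nat -> L2) :
  (forall k, L2_norm (v k.+1 - v k) <= (2 ^+ k)^-1) ->
  exists2 f : T -> R, measurable_fun setT f &
    {ae mu, forall x, Lp_fun (v k) x @[k --> \oo] --> f x}.
Proof.
move=> vP.
(* An upper limit is measurable whether or not the sequence converges, and equals the limit where it
   does. *)
exists (fun x => fine (limn_esup (fun k => (Lp_fun (v k) x)%:E))).
  apply: (measurableT_comp (fine_measurable measurableT)).
  apply: measurable_fun_limn_esup => k.
  by apply/measurable_EFinP; exact: Lp_fun_measurable.
suff : {ae mu, forall x, cvgn (fun k => Lp_fun (v k) x)}.
  apply: filterS => x cx; set l := limn (fun k => Lp_fun (v k) x).
  have lP : (fun k => (Lp_fun (v k) x)%:E) @ \oo --> l%:E by apply: cvg_EFin; [exact: nearW|exact: cx].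
  by rewrite (cvg_limn_einf_sup lP).2.
pose g k x := (2 ^+ k * (Lp_fun (v k.+1) x - Lp_fun (v k) x) ^+ 2)%:E.
have mg k : measurable_fun setT (g k).
  apply/measurable_EFinP; apply: measurable_funM => //; apply: measurable_funX.
  by apply: measurable_funB; exact: Lp_fun_measurable.
have g0 k x : (0 <= g k x)%E by rewrite lee_fin mulr_ge0 ?sqr_ge0 ?exprn_ge0.
have mG : measurable_fun setT (fun x => \sum_(k <oo) g k x)%E.
  by apply: ge0_emeasurable_sum.
have gk k : (\int[mu]_x g k x <= ((2 ^+ k)^-1)%:E)%E.
  have mB : measurable_fun setT (fun x => Lp_fun (v k.+1) x - Lp_fun (v k) x).
    by apply: measurable_funB; exact: Lp_fun_measurable.
  rewrite (_ : g k = (fun x => (2 ^+ k)%:E * ((Lp_fun (v k.+1) x - Lp_fun (v k) x) ^+ 2)%:E)%E)//.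
  rewrite ge0_integralZl//; last 2 first.
  - exact: measurable_sqr_EFin.
  - by move=> x _; rewrite lee_fin sqr_ge0.
  rewrite -(L2_ip_integral mB (Lp_aeB _ _)) -EFinM lee_fin.
  have := vP k; rewrite /L2_norm => vk.
  rewrite -ler_pdivlMl ?exprn_gt0// -expr2 -ler_sqrt ?sqr_ge0// sqrtr_sqr.
  by rewrite ger0_norm// invr_ge0 exprn_ge0.
have : mu.-integrable setT (fun x => \sum_(k <oo) g k x)%E.
  apply/integrableP; split => //.
  rewrite (eq_integral (fun x => \sum_(k <oo) g k x)%E); last first.
    by move=> x _; rewrite gee0_abs// nneseries_ge0.
  rewrite integral_nneseries// (@le_lt_trans _ _ 2%:E) ?ltry//.
  apply: lime_le; first by apply: is_cvg_nneseries => k _ _; exact: integral_ge0.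
  apply: nearW => n; rewrite big_mkord.
  apply: (@le_trans _ _ (\sum_(k < n) ((2 ^+ k)^-1)%:E)%E); first exact: lee_sum.
  rewrite sumEFin lee_fin.
  by rewrite sum_half_pow gerBl divr_ge0// exprn_ge0.
move=> /(integrable_ae measurableT); apply: filterS => x /(_ I) Gfin.
apply: (@cvg_weighted_increments _ (fine (\sum_(k <oo) g k x)%E)) => n.
rewrite -lee_fin fineK// -sumEFin -(big_mkord xpredT (fun k => g k x)).
by apply: nneseries_lim_ge => k _ _; exact: g0.
Qed.

(** Fatou's lemma for the squares [(w - v k) ^+ 2], shifted by [k0]. The integral stays
    extended-real because [f] is not yet known to be in L^2. *)
Lemma L2_fatou (v : nat -> L2) (w : L2) (f : T -> R) (c : R) k0 :
  measurable_fun setT f ->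
  {ae mu, forall x, Lp_fun (v k) x @[k --> \oo] --> f x} ->
  (forall k, (k0 <= k)%N -> L2_norm (w - v k) <= c) ->
  (\int[mu]_x ((Lp_fun w x - f x) ^+ 2)%:E <= (c ^+ 2)%:E)%E.
Proof.
move=> mf vf wv; pose g k x := ((Lp_fun w x - Lp_fun (v (k + k0)%N) x) ^+ 2)%:E.
have mw k : measurable_fun setT (fun x => Lp_fun w x - Lp_fun (v k) x).
  by apply: measurable_funB; exact: Lp_fun_measurable.
have mg k : measurable_fun setT (g k) by exact: measurable_sqr_EFin.
have gl : {ae mu, forall x, ((Lp_fun w x - f x) ^+ 2)%:E = limn_einf (g^~ x)}.
  apply: filterS vf => x vx.
  have gx : (g^~ x) k @[k --> \oo] --> ((Lp_fun w x - f x) ^+ 2)%:E.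
    have h : Lp_fun w x - Lp_fun (v (k + k0)%N) x @[k --> \oo] --> Lp_fun w x - f x.
      by apply: cvgB; [exact: cvg_cst|move: vx; rewrite -(cvg_shiftn k0)].
    by apply: cvg_EFin; [exact: nearW|exact: (cvgM h h)].
  by rewrite (cvg_limn_einf_sup gx).1.
rewrite (ae_eq_integral (fun x => limn_einf (g^~ x)))//; first last.
- by apply: filterS gl => x + _.
- rewrite (_ : (fun x => _) = (fun x => - limn_esup (fun k => - g k x))%E).
    apply: measurableT_comp => //; apply: measurable_fun_limn_esup => k.
    exact: measurableT_comp.
  apply/funext => x; rewrite -limn_einfN; congr limn_einf.
  by apply/funext => k; rewrite [RHS]oppeK.
- by apply: measurable_sqr_EFin; apply: measurable_funB => //; exact: Lp_fun_measurable.
apply: le_trans (fatou mu measurableT mg _) _.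
  by move=> k x _; rewrite lee_fin sqr_ge0.
have gc k : (\int[mu]_x g k x <= (c ^+ 2)%:E)%E.
  rewrite /g -(L2_ip_integral (mw _) (Lp_aeB _ _)) lee_fin.
  have := wv (k + k0)%N (leq_addl _ _); rewrite /L2_norm => h.
  rewrite -[leLHS]sqr_sqrtr ?L2_ip_ge0// ler_pXn2r ?nnegrE ?sqrtr_ge0//.
  exact: le_trans h.
rewrite limn_einf_lim; apply: lime_le.
  exact: is_cvg_einfs.
apply: nearW => n; rewrite /einfs; apply: le_trans (gc n).
by apply: ereal_inf_lbound; exists n => /=.
Qed.

(** A subsequence with geometrically small gaps has an almost everywhere limit; Fatou along it
    controls the distance from every late [u n] to that limit, so the whole sequence converges. *)
Lemma L2_complete : complete_wrt (@L2_norm _ _ _ mu).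
Proof.
move=> u uC; have NS := @L2_norm_seminorm _ _ _ mu.
have /choice[nk nkP] k : exists n0, forall m n, (n0 <= m)%N -> (n0 <= n)%N ->
    L2_norm (u m - u n) < (2 ^+ k)^-1 by apply: uC; rewrite invr_gt0 exprn_gt0.
(* Adding up the thresholds makes [ph] monotone and at least [nk k]; the summand [k] makes it at
   least [k]. *)
pose ph k := (k + \sum_(i < k.+1) nk i)%N.
have phS k : (ph k <= ph k.+1)%N by rewrite /ph [in leqRHS]big_ord_recr/=; lia.
have ph_ge k : (nk k <= ph k)%N by rewrite /ph big_ord_recr/=; lia.
have ph_id k : (k <= ph k)%N by rewrite /ph leq_addr.
pose v k := u (ph k).
have [|f mf vf] := @L2_ae_cvg v.
  by move=> k; apply/ltW/nkP; rewrite ?(leq_trans _ (phS k)).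
have fat n c k0 : (forall k, (k0 <= k)%N -> L2_norm (u n - v k) <= c) ->
    (\int[mu]_x ((Lp_fun (u n) x - f x) ^+ 2)%:E <= (c ^+ 2)%:E)%E.
  exact: L2_fatou.
(* One index at finite distance puts the limit in L^2: it is [u n1] minus the square-integrable
   [u n1 - f]. *)
have [n1 n1P] := uC _ ltr01.
have h1 : (\int[mu]_x ((Lp_fun (u n1) x - f x) ^+ 2)%:E <= (1 ^+ 2)%:E)%E.
  apply: (fat n1 1 n1) => k nk1; apply/ltW/n1P => //.
  exact: leq_trans nk1 (ph_id k).
have mL : (fun x => Lp_fun (u n1) x - f x) \in Lfun mu 2%:R%:E.
  have mm : measurable_fun setT (fun x => Lp_fun (u n1) x - f x).
    by apply: measurable_funB => //; exact: Lp_fun_measurable.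
  apply/andP; split; rewrite inE//=.
  rewrite /finite_norm unlock /Lnorm poweR_lty//.
  under eq_integral => x _ do rewrite /= powR_mulrn// real_normK ?num_real//.
  by apply: le_lt_trans h1 _; rewrite ltry.
pose F : LfunType mu (lee1n 2) := Lp_repr (u n1) - Lfun_Sub (lee1n 2) mL.
have FE x : F x = f x.
  by rewrite [LHS](_ : _ = Lp_fun (u n1) x - (Lp_fun (u n1) x - f x))//; ring.
exists (Lp_class F) => e e0.
have e2 : 0 < e / 2 by rewrite divr_gt0.
have [n0 n0P] := uC _ e2.
exists n0 => n nn.
have : (\int[mu]_x ((Lp_fun (u n) x - f x) ^+ 2)%:E <= ((e / 2) ^+ 2)%:E)%E.
  apply: (fat n (e / 2) n0) => k nk0; apply/ltW/n0P => //.
  exact: leq_trans nk0 (ph_id k).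
rewrite -(@L2_ip_integral _ _ _ mu (u n - Lp_class F)); last 2 first.
- by apply: measurable_funB => //; exact: Lp_fun_measurable.
- apply: filterS2 (Lp_aeB (u n) (Lp_class F)) (Lp_class_ae F) => x -> ->.
  by rewrite FE.
rewrite lee_fin => h; rewrite /L2_norm.
apply: (@le_lt_trans _ _ (e / 2)); last by lra.
by rewrite -[leRHS]ger0_norm ?(ltW e2)// -sqrtr_sqr ler_wsqrtr.
Qed.

End L2_complete.

(** * Tensor fields: completeness of [Q] and the action of [Qinf] *)

Section submod_operations.
Context {R : pzRingType} {E : lmodType R} {P : submodClosed E}.
Implicit Types x y : submod P.

Lemma submod_valD x y : submod_val (x + y) = submod_val x + submod_val y.
Proof. by []. Qed.

Lemma submod_valB x y : submod_val (x - y) = submod_val x - submod_val y.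
Proof. by []. Qed.

Lemma submod_valZ a x : submod_val (a *: x) = a *: submod_val x.
Proof. by []. Qed.

End submod_operations.

Section Q_facts.
Context {R : realType} {d : nat} (Om : set 'rV[R]_d).

Lemma Q_norm_seminorm : seminorm (@Q_norm R d Om).
Proof.
by apply: sip_seminorm; [exact: Q_ipC|exact: Q_ip_ge0|exact: Q_ipP].
Qed.

Lemma Q_compD (s t : Qspace Om) i j : Q_comp (s + t) i j = Q_comp s i j + Q_comp t i j.
Proof. by rewrite /Q_comp submod_valD. Qed.

Lemma Q_compB (s t : Qspace Om) i j : Q_comp (s - t) i j = Q_comp s i j - Q_comp t i j.
Proof. by rewrite /Q_comp submod_valB. Qed.

Lemma Qinf_compD (D D' : Qinf Om) i j k l :
  Qinf_comp (D + D') i j k l = Qinf_comp D i j k l + Qinf_comp D' i j k l.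
Proof. by rewrite /Qinf_comp submod_valD. Qed.

Lemma Qinf_compB (D D' : Qinf Om) i j k l :
  Qinf_comp (D - D') i j k l = Qinf_comp D i j k l - Qinf_comp D' i j k l.
Proof. by rewrite /Qinf_comp submod_valB. Qed.

Lemma Qinf_compZ a (D : Qinf Om) i j k l :
  Qinf_comp (a *: D) i j k l = a *: Qinf_comp D i j k l.
Proof. by rewrite /Qinf_comp submod_valZ. Qed.

Lemma L2_norm_Q_comp (s : Qspace Om) i j : L2_norm (Q_comp s i j) <= Q_norm s.
Proof.
rewrite ler_wsqrtr// /Q_ip (bigD1 i)//= (bigD1 j)//= -addrA lerDl.
rewrite addr_ge0 ?sumr_ge0// => k _; rewrite ?sumr_ge0// => *; exact: L2_ip_ge0.
Qed.

Lemma sum_sqr_le (I : Type) (r : seq I) (a : I -> R) : (forall i, 0 <= a i) ->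
  \sum_(i <- r) a i ^+ 2 <= (\sum_(i <- r) a i) ^+ 2.
Proof.
move=> a0; elim: r => [|i r IH]; first by rewrite !big_nil expr0n.
rewrite !big_cons sqrrD -addrA lerD2l (le_trans IH)// lerDr mulrn_wge0//.
by rewrite mulr_ge0// sumr_ge0.
Qed.

Lemma Q_norm_le_sum (s : Qspace Om) :
  Q_norm s <= \sum_i \sum_j L2_norm (Q_comp s i j).
Proof.
have s0 i : 0 <= \sum_j L2_norm (Q_comp s i j).
  by apply: sumr_ge0 => j _; exact: sqrtr_ge0.
rewrite -[leRHS]ger0_norm ?sumr_ge0// -sqrtr_sqr ler_wsqrtr//.
apply: le_trans (sum_sqr_le _ s0); apply: ler_sum => i _.
apply: le_trans (sum_sqr_le _ _) => [|j]; last exact: sqrtr_ge0.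
by apply: ler_sum => j _; rewrite sqr_sqrtr// L2_ip_ge0.
Qed.

Lemma Q_complete : complete_wrt (@Q_norm R d Om).
Proof.
move=> u uC.
have lim_comp i j : exists l, forall e, 0 < e -> exists n0, forall n, (n0 <= n)%N ->
    L2_norm (Q_comp (u n) i j - l) < e.
  apply: (@L2_complete _ _ _ _ (fun n => Q_comp (u n) i j)) => e /uC[n0 n0P].
  exists n0 => m n mn nn; apply: le_lt_trans (n0P _ _ mn nn).
  by rewrite -Q_compB; exact: L2_norm_Q_comp.
pose l i j := projT1 (cid (lim_comp i j)).
have lP i j : forall e, 0 < e -> exists n0, forall n, (n0 <= n)%N ->
    L2_norm (Q_comp (u n) i j - l i j) < e := projT2 (cid (lim_comp i j)).
(* The limits at [(i, j)] and [(j, i)] were chosen independently, so one triangle is mirrored to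
   obtain a symmetric tensor. *)
pose ls (i j : 'I_d) := if (i <= j)%N then l i j else l j i.
have lsS : ls \in @sym2_pred R _ _.
  apply/sym2_predP => i j; rewrite /ls.
  by case: ltngtP => // /ord_inj ->.
have lsP i j : forall e, 0 < e -> exists n0, forall n, (n0 <= n)%N ->
    L2_norm (Q_comp (u n) i j - ls i j) < e.
  rewrite /ls; case: ifP => _ e e0; first exact: lP.
  have [n0 n0P] := lP j i _ e0; exists n0 => n nn.
  have /sym2_predP E := submod_valP (u n).
  by rewrite /Q_comp E; exact: n0P.
exists (Submod lsS) => e e0.
(* There are [d * d] entries; the successor keeps their total strictly below [e]. *)
have e'0 : 0 < e / (d * d).+1%:R by rewrite divr_gt0.
pose n0 i j := projT1 (cid (lsP i j _ e'0)).
have n0P i j : forall n, (n0 i j <= n)%N -> L2_norm (Q_comp (u n) i j - ls i j) <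
    e / (d * d).+1%:R := projT2 (cid (lsP i j _ e'0)).
exists (\max_i \max_j n0 i j) => n nn.
apply: le_lt_trans (Q_norm_le_sum _) _.
apply: (@le_lt_trans _ _ (\sum_(i < d) \sum_(j < d) e / (d * d).+1%:R)).
  apply: ler_sum => i _; apply: ler_sum => j _; rewrite Q_compB; apply/ltW/n0P.
  apply: leq_trans nn; apply: leq_trans (leq_bigmax i).
  exact: (leq_bigmax (F := fun j => n0 i j)).
rewrite !sumr_const !card_ord -mulrnA -[ltLHS]mulr_natr.
by rewrite mulrAC ltr_pdivrMr// ltr_pM2l// ltr_nat.
Qed.

Lemma Linf_norm_Qinf_comp (D : Qinf Om) i j k l :
  Linf_norm (Qinf_comp D i j k l) <= Qinf_norm D.
Proof.
rewrite /Qinf_norm.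
apply: le_trans (le_bigmax _ _ i); apply: le_trans (le_bigmax _ _ j).
by apply: le_trans (le_bigmax _ _ k); exact: le_bigmax.
Qed.

Lemma Qinf_norm_le (D : Qinf Om) M : 0 <= M ->
  (forall i j k l, Linf_norm (Qinf_comp D i j k l) <= M) -> Qinf_norm D <= M.
Proof. by move=> M0 DM; do 4! [apply: bigmax_le => // ? _]. Qed.

Lemma Qinf_norm_ge0 (D : Qinf Om) : 0 <= Qinf_norm D.
Proof. exact: bigmax_ge_id. Qed.

Lemma Qinf_norm_seminorm : seminorm (@Qinf_norm R d Om).
Proof.
have [LD LZ] := Linf_norm_seminorm (mlebesgue Om).
apply: le_seminorm => [D D'|a D].
  apply: Qinf_norm_le => [|i j k l]; first by rewrite addr_ge0 ?Qinf_norm_ge0.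
  rewrite Qinf_compD (le_trans (LD _ _))// lerD//; exact: Linf_norm_Qinf_comp.
apply: Qinf_norm_le => [|i j k l]; first by rewrite mulr_ge0 ?Qinf_norm_ge0.
rewrite Qinf_compZ LZ.
by rewrite ler_wpM2l// Linf_norm_Qinf_comp.
Qed.

(** [d ^+ 4] counts the index quadruples, each entry being bounded by the norm of the whole
    tensor. *)
Lemma Qinf_act_norm (D : Qinf Om) (s : Qspace Om) :
  Q_norm (Qinf_act D s) <= d%:R ^+ 4 * Qinf_norm D * Q_norm s.
Proof.
apply: le_trans (Q_norm_le_sum _) _.
apply: (@le_trans _ _
    (\sum_(i < d) \sum_(j < d) \sum_(k < d) \sum_(l < d) Qinf_norm D * Q_norm s)).
  apply: ler_sum => i _; apply: ler_sum => j _.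
  have NS := L2_norm_seminorm (mlebesgue Om).
  apply: le_trans (seminorm_sum NS _ _ _) _; apply: ler_sum => k _.
  apply: le_trans (seminorm_sum NS _ _ _) _; apply: ler_sum => l _.
  apply: le_trans (Linf_act_norm _ _) _.
  by rewrite ler_pM ?Linf_norm_ge0 ?sqrtr_ge0 ?Linf_norm_Qinf_comp ?L2_norm_Q_comp.
rewrite !sumr_const !card_ord -!mulrnA -[leLHS]mulr_natl !natrM.
by move: d%:R => c; rewrite le_eqVlt; apply/orP; left; apply/eqP; ring.
Qed.

(** Used when both factors move, for the continuity of the history integrand, and with [D = D'] for
    the difference of two histories. *)
Lemma Qinf_actB (D D' : Qinf Om) (s s' : Qspace Om) :
  Qinf_act D s - Qinf_act D' s' = Qinf_act (D - D') s + Qinf_act D' (s - s').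
Proof.
apply: Q_ext => i j.
transitivity (\sum_k \sum_l (Linf_act (Qinf_comp D i j k l) (Q_comp s k l) -
    Linf_act (Qinf_comp D' i j k l) (Q_comp s' k l))).
  by rewrite Q_compB -sumrB; apply: eq_bigr => k _; rewrite -sumrB.
rewrite Q_compD -big_split; apply: eq_bigr => k _; rewrite -big_split; apply: eq_bigr => l _.
by rewrite Qinf_compB Q_compB; exact: Linf_actB.
Qed.

End Q_facts.

(** * Comparison of solutions of the variational inequality *)

Section problem_facts.
Context {R : realType} {d : nat} {Om Gam1 : set 'rV[R]_d}.
Local Notation V := (Vspace Om Gam1).
Local Notation Q := (Qspace Om).
Local Notation V' := (Vdual Om Gam1).

Lemma epsD (u v : V) : eps (u + v) = eps u + eps v.
Proof. by rewrite -[u in LHS]scale1r epsP scale1r. Qed.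

Lemma eps0 : eps (0 : V) = 0.
Proof. by apply: (addrI (eps (0 : V))); rewrite -epsD !addr0. Qed.

Lemma epsZ a (v : V) : eps (a *: v) = a *: eps v.
Proof. by rewrite -[a *: v]addr0 epsP eps0 addr0. Qed.

Lemma epsB (u v : V) : eps (u - v) = eps u - eps v.
Proof. by rewrite -scaleN1r epsD epsZ scaleN1r. Qed.

Lemma V_normE (v : V) : V_norm v = Q_norm (eps v).
Proof. by []. Qed.

Lemma V_norm_seminorm : seminorm (@V_norm R d Om Gam1).
Proof.
have [QD QZ] := Q_norm_seminorm Om.
by split=> [u v|a v]; rewrite !V_normE ?epsD ?epsZ.
Qed.

Lemma pairingP (w : V') a u v : pairing w (a *: u + v) = a * pairing w u + pairing w v.
Proof. by have /dual_predP[+ _] := submod_valP w; apply. Qed.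

Lemma pairingN (w : V') v : pairing w (- v) = - pairing w v.
Proof.
have p0 : pairing w 0 = 0.
  by have := pairingP w 1 0 0; rewrite scale1r addr0 mul1r; lra.
by rewrite -scaleN1r -[_ *: _]addr0 pairingP p0 addr0 mulN1r.
Qed.

Lemma pairingDl (w w' : V') v : pairing (w + w') v = pairing w v + pairing w' v.
Proof. by rewrite /pairing submod_valD. Qed.

Lemma pairingBl (w w' : V') v : pairing (w - w') v = pairing w v - pairing w' v.
Proof. by rewrite /pairing submod_valB. Qed.

Lemma Q_ipDr (r s t : Q) : Q_ip r (s + t) = Q_ip r s + Q_ip r t.
Proof. by rewrite -[s in LHS]scale1r Q_ipP mul1r. Qed.

Lemma Q_ipNr (r s : Q) : Q_ip r (- s) = - Q_ip r s.
Proof.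
have r0 : Q_ip r 0 = 0.
  by have := Q_ipDr r 0 0; rewrite addr0; lra.
by rewrite -scaleN1r -[_ *: _]addr0 Q_ipP r0 addr0 mulN1r.
Qed.

Lemma Q_ipBl (r s t : Q) : Q_ip (r - s) t = Q_ip r t - Q_ip s t.
Proof. by rewrite Q_ipC Q_ipDr Q_ipNr !(Q_ipC t). Qed.

Lemma Q_ip_CS (s t : Q) : `|Q_ip s t| <= Q_norm s * Q_norm t.
Proof. by apply: sip_CS; [exact: Q_ipC|exact: Q_ip_ge0|exact: Q_ipP]. Qed.

(* Each solution is tested with the other one. *)
Lemma VI_comparison (B : {linear Q -> Q}) (P : V -> V') m (om : V') (h h' : Q) (u w : V) e :
  (forall tau, m * Q_norm tau ^+ 2 <= Q_ip (B tau) tau) -> monotone_op P -> 0 <= e ->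
  pairing om (w - u) <= Q_ip (B (eps u)) (eps w - eps u) + Q_ip h (eps w - eps u) +
    pairing (P u) (w - u) ->
  pairing om (u - w) <= Q_ip (B (eps w)) (eps u - eps w) + Q_ip h' (eps u - eps w) +
    pairing (P w) (u - w) + e * V_norm (u - w) ->
  m * V_norm (w - u) <= Q_norm (h' - h) + e.
Proof.
move=> Bm Pm e0 VIu VIw; set z := w - u.
have zE : u - w = - z by rewrite opprB.
have ezE : eps u - eps w = - eps z by rewrite epsB opprB.
rewrite (_ : eps w - eps u = eps z) in VIu; last by rewrite epsB.
move: VIw; rewrite zE ezE !pairingN !Q_ipNr (seminormN V_norm_seminorm) => VIw.
have := Bm (eps z); rewrite -V_normE.
have := Pm w u; rewrite pairingBl -/z => Pz.
have Bz : Q_ip (B (eps z)) (eps z) = Q_ip (B (eps w)) (eps z) - Q_ip (B (eps u)) (eps z).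
  by rewrite epsB linearB Q_ipBl.
have CS : - (Q_norm (h' - h) * V_norm z) <= Q_ip h' (eps z) - Q_ip h (eps z).
  by rewrite -Q_ipBl; have := Q_ip_CS (h' - h) (eps z); rewrite ler_norml => /andP[].
rewrite Bz => mz.
(* In the sum of the two inequalities the [om] terms cancel, [Pz] disposes of the [P] terms and
   coercivity bounds the [B] terms from below. *)
have key : V_norm z * (m * V_norm z) <= V_norm z * (Q_norm (h' - h) + e).
  move: VIu VIw CS mz Pz; rewrite expr2.
  move: (pairing om z) (pairing (P w) z) (pairing (P u) z) (Q_ip (B (eps w)) _).
  move: (Q_ip (B (eps u)) _) (Q_ip h' _) (Q_ip h _) (V_norm z) (Q_norm _).
  by move=> *; lra.
have [z0|z0] := eqVneq (V_norm z) 0.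
  by rewrite z0 mulr0 addr_ge0// (seminorm_ge0 (Q_norm_seminorm Om)).
by move: key; rewrite ler_pM2l// lt_def z0 (seminorm_ge0 V_norm_seminorm).
Qed.

End problem_facts.

(** * The history operator and Gronwall's argument *)

Section history_facts.
Context {R : realType} {d : nat} {Om Gam1 : set 'rV[R]_d}.
Local Notation V := (Vspace Om Gam1).
Variables (T : R) (Rel : R -> Qinf Om).
Hypothesis Rel_C : in_C (@Qinf_norm R d Om) T Rel.
Let VS := @V_norm_seminorm R d Om Gam1.
Let QS := Q_norm_seminorm Om.
Let IS := Qinf_norm_seminorm Om.

(** [Rel] and [u] are bounded and uniformly continuous on [[0, T]], so their product
    [s |-> Rel (t - s) (eps (u s))] is uniformly continuous on [[0, t]]. *)
Lemma history_is_vint (u : R -> V) t : in_C (@V_norm R d Om Gam1) T u ->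
  t \in `[0, T] -> is_vint (@Q_norm R d Om) 0 t
    (fun s => Qinf_act (Rel (t - s)) (eps (u s))) (history Rel u t).
Proof.
move=> uC; rewrite in_itv/= => /andP[t0 tT]; apply: vintP.
apply: is_vint_exists => //; first exact: Q_complete.
have [Mu [Mu0 uM]] := in_C_bounded VS uC.
have [Mr [Mr0 rM]] := in_C_bounded IS Rel_C.
pose K : R := d%:R ^+ 4; have K0 : 0 <= K by rewrite exprn_ge0.
move=> e e0.
(* Half of [e] pays for the increment of [Rel] against the bound [Mu], half for the increment of [u]
   against [Mr]. *)
have e1 : 0 < e / (2 * (K * Mu + 1)) by rewrite divr_gt0// mulr_gt0// ltr_wpDl// mulr_ge0.
have e2 : 0 < e / (2 * (K * Mr + 1)) by rewrite divr_gt0// mulr_gt0// ltr_wpDl// mulr_ge0.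
have [d1 d10 rU] := in_C_unif IS Rel_C e1.
have [d2 d20 uU] := in_C_unif VS uC e2.
exists (Num.min d1 d2); first by rewrite lt_min d10.
move=> s s' /andP[s0 st] /andP[s'0 s't]; rewrite lt_min => /andP[ss1 ss2].
have sT : s \in `[0, T] by rewrite in_itv/= s0 (le_trans st).
have s'T : s' \in `[0, T] by rewrite in_itv/= s'0 (le_trans s't).
have tsT : t - s \in `[0, T] by rewrite in_itv/=; apply/andP; split; lra.
have ts'T : t - s' \in `[0, T] by rewrite in_itv/=; apply/andP; split; lra.
rewrite Qinf_actB -epsB; apply: le_lt_trans (QS.1 _ _) _.
have r1 : Qinf_norm (Rel (t - s) - Rel (t - s')) < e / (2 * (K * Mu + 1)).
  apply: rU => //; rewrite (_ : _ - _ = s' - s); last by ring.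
  by rewrite distrC.
have r2 : V_norm (u s - u s') < e / (2 * (K * Mr + 1)) by exact: uU.
have b1 : Q_norm (Qinf_act (Rel (t - s) - Rel (t - s')) (eps (u s))) <=
    K * (e / (2 * (K * Mu + 1))) * Mu.
  apply: le_trans (Qinf_act_norm _ _) _; rewrite -V_normE.
  apply: ler_pM; [|exact: (seminorm_ge0 VS)| |exact: uM].
    by rewrite mulr_ge0// (seminorm_ge0 IS).
  by rewrite ler_wpM2l// ltW.
have b2 : Q_norm (Qinf_act (Rel (t - s')) (eps (u s - u s'))) <=
    K * Mr * (e / (2 * (K * Mr + 1))).
  apply: le_trans (Qinf_act_norm _ _) _; rewrite -V_normE.
  apply: ler_pM; [|exact: (seminorm_ge0 VS)| |exact: ltW].
    by rewrite mulr_ge0// (seminorm_ge0 IS).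
  by rewrite ler_wpM2l// rM.
have half M : 0 <= M -> K * M * (e / (2 * (K * M + 1))) < e / 2.
  move=> M0; have KM : 0 <= K * M by rewrite mulr_ge0.
  rewrite mulrA ltr_pdivrMr; last by rewrite mulr_gt0// ltr_wpDl.
  by move: (K * M) KM => y y0; nra.
have h1 := half _ Mu0; have h2 := half _ Mr0.
by rewrite mulrAC in b1; lra.
Qed.

(** Integrating [M * expR (lam * s)] gains [1 / lam], while [C] is [d ^+ 4] times a bound on [Rel]
    over [[0, T]]; being chosen before [lam], it can be beaten by [lam]. *)
Lemma history_close : exists2 C, 0 <= C & forall (u w : R -> V) lam M t,
  in_C (@V_norm R d Om Gam1) T u -> in_C (@V_norm R d Om Gam1) T w ->
  0 < lam -> 0 <= M -> t \in `[0, T] ->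
  (forall s, s \in `[0, T] -> V_norm (u s - w s) <= M * expR (lam * s)) ->
  Q_norm (history Rel u t - history Rel w t) <= C * M / lam * expR (lam * t).
Proof.
have [Mr [Mr0 rM]] := in_C_bounded IS Rel_C.
exists (d%:R ^+ 4 * Mr); first by rewrite mulr_ge0// exprn_ge0.
move=> u w lam M t uC wC lam0 M0 tT uwM.
have C0 : 0 <= d%:R ^+ 4 * Mr by rewrite mulr_ge0// exprn_ge0.
have := tT; rewrite in_itv/= => /andP[t0 tT'].
apply: (vint_sub_expR QS t0 lam0 _ (history_is_vint uC tT) (history_is_vint wC tT)).
  by rewrite mulr_ge0.
move=> s /andP[s0 st].
have sT : s \in `[0, T] by rewrite in_itv/= s0 (le_trans st).
have tsT : t - s \in `[0, T] by rewrite in_itv/=; apply/andP; split; lra.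
have -> : Qinf_act (Rel (t - s)) (eps (u s)) - Qinf_act (Rel (t - s)) (eps (w s)) =
    Qinf_act (Rel (t - s) - Rel (t - s)) (eps (u s)) +
    Qinf_act (Rel (t - s)) (eps (u s - w s)).
  by rewrite Qinf_actB -epsB.
apply: le_trans (QS.1 _ _) _.
have z : Q_norm (Qinf_act (Rel (t - s) - Rel (t - s)) (eps (u s))) <= 0.
  by apply: le_trans (Qinf_act_norm _ _) _; rewrite subrr (seminorm0 IS) mulr0 mul0r.
apply: le_trans (lerD z (lexx _)) _.
rewrite add0r; apply: le_trans (Qinf_act_norm _ _) _; rewrite -V_normE -[leRHS]mulrA.
apply: ler_pM; [|exact: (seminorm_ge0 VS)| |exact: uwM].
  by rewrite mulr_ge0 ?exprn_ge0// (seminorm_ge0 IS).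
by rewrite ler_wpM2l ?exprn_ge0// rM.
Qed.

(* Gronwall's argument, with the weighted norm [sup_t expR (- lam * t) * |v t|]
   in which the history operator is a contraction for large [lam]. *)
Lemma C_cvg_history (un : nat -> R -> V) (u : R -> V) (c : R) (e : nat -> R) :
  0 < T -> 0 <= c ->
  (forall n, in_C (@V_norm R d Om Gam1) T (un n)) -> in_C (@V_norm R d Om Gam1) T u ->
  (forall n, 0 <= e n) -> e n @[n --> \oo] --> 0 ->
  (forall n t, t \in `[0, T] ->
    V_norm (un n t - u t) <= c * Q_norm (history Rel (un n) t - history Rel u t) + e n) ->
  C_cvg (@V_norm R d Om Gam1) T un u.
Proof.
move=> T0 c0 unC uC e0 ecvg unu; have [C C0 hC] := history_close.
(* Makes [c * C / lam <= 1 / 2]; the [+ 1] keeps [lam] positive when [c * C = 0]. *)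
pose lam := 2 * (c * C) + 1.
have lam0 : 0 < lam by rewrite ltr_wpDl// mulr_ge0// mulr_ge0.
have [Mu [Mu0 uM]] := in_C_bounded VS uC.
(* The factor 2 comes from [M <= 2 * e n], the exponential from undoing the weight. *)
apply: (@C_cvgW _ _ _ _ VS _ _ (fun n => 2 * expR (lam * T) * e n)); first exact: ltW.
  rewrite -[X in _ --> X](mulr0 (2 * expR (lam * T))).
  by apply: cvgM => //; exact: cvg_cst.
move=> n; have [Mn [Mn0 nM]] := in_C_bounded VS (unC n).
pose S := [set V_norm (un n t - u t) * expR (- (lam * t)) | t in `[0, T]%classic].
have S0 : S (V_norm (un n 0 - u 0) * expR (- (lam * 0))).
  by exists 0 => //=; rewrite in_itv/= lexx ltW.
have Sub : ubound S (Mn + Mu).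
  move=> _ [t tT <-]; have tT' : t \in `[0, T] by [].
  have t0 : 0 <= t by move: tT'; rewrite in_itv/= => /andP[].
  rewrite -[leRHS]mulr1; apply: ler_pM.
  - exact: (seminorm_ge0 VS).
  - exact: expR_ge0.
  - apply: le_trans (VS.1 _ _) _; rewrite (seminormN VS).
    by apply: lerD; [exact: nM|exact: uM].
  - by rewrite -expR0 ler_expR oppr_le0 mulr_ge0// ltW.
have supS : has_sup S by split; [exists (V_norm (un n 0 - u 0) * expR (- (lam * 0)))|exists (Mn + Mu)].
pose M := sup S.
have leM t : t \in `[0, T] -> V_norm (un n t - u t) <= M * expR (lam * t).
  move=> tT; rewrite -ler_pdivrMr ?expR_gt0// -expRN.
  by apply: ub_le_sup; [exact: supS.2|exists t].
have M0 : 0 <= M.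
  have := leM 0; rewrite in_itv/= lexx ltW// mulr0 expR0 mulr1 => /(_ isT).
  exact: le_trans (seminorm_ge0 VS _).
have cl t : t \in `[0, T] -> V_norm (un n t - u t) <= M / 2 * expR (lam * t) + e n.
  move=> tT; apply: le_trans (unu n t tT) _; rewrite lerD2r.
  apply: le_trans (ler_wpM2l c0 (hC _ _ lam M t (unC n) uC lam0 M0 tT leM)) _.
  rewrite !mulrA ler_wpM2r ?expR_ge0// ler_pdivrMr// /lam.
  have : 0 <= c * C * M by rewrite !mulr_ge0.
  by move: (c * C) => k; lra.
(* Multiplying [cl] by the weight, which is at most 1 for [t >= 0], does not enlarge [e n]. *)
have Me : M <= M / 2 + e n.
  apply: ge_sup => [|_ [t tT <-]]; first exact: supS.1.
  have tT' : t \in `[0, T] by [].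
  have t0 : 0 <= t by move: tT'; rewrite in_itv/= => /andP[].
  rewrite expRN ler_pdivrMr ?expR_gt0//; apply: le_trans (cl t tT') _.
  rewrite [leRHS]mulrDl lerD2l ler_peMr// -[leLHS]expR0 ler_expR mulr_ge0//.
  exact: ltW.
move=> t tT; apply: le_trans (leM t tT) _.
have tT' : t <= T by move: tT; rewrite in_itv/= => /andP[].
apply: (@le_trans _ _ (2 * e n * expR (lam * T))).
  apply: ler_pM; [exact: M0|exact: expR_ge0| |].
    by lra.
  by rewrite ler_expR ler_wpM2l// ltW.
by rewrite mulrAC.
Qed.

End history_facts.

(** * Convergence of the approximating sequences *)

Theorem theorem17 (R : realType) (d : nat) (hd : (1 <= d <= 3)%N)
  (Om : set 'rV[R]_d) (hOm : smooth_bounded_domain Om)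
  (Gam1 : set 'rV[R]_d) (hGam1 : Gam1 `<=` frontier Om)
  (mGam1 : (hausdorff_outer d.-1).-caratheodory Gam1)
  (posGam1 : (0 < hausdorff_outer d.-1 Gam1)%E)
  (T : R) (T_gt0 : 0 < T)
  (U : set (Vspace Om Gam1)) (U_neq0 : U !=set0)
  (U_closed : closed_wrt (@V_norm R d Om Gam1) U)
  (U_convex : convex_set (U : set (convex_lmodType (Vspace Om Gam1))))
  (B : {linear Qspace Om -> Qspace Om})
  (B_continuous : continuous_wrt (@Q_norm R d Om) (@Q_norm R d Om) B)
  (B_coercive : exists2 m : R, 0 < m &
     forall tau, m * Q_norm tau ^+ 2 <= Q_ip (B tau) tau)
  (Rel : R -> Qinf Om) (Rel_C : in_C (@Qinf_norm R d Om) T Rel)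
  (P : Vspace Om Gam1 -> Vdual Om Gam1)
  (P_lipschitz :
     lipschitz_wrt (@V_norm R d Om Gam1) (@Vdual_norm R d Om Gam1) P)
  (P_monotone : monotone_op P)
  (f : R -> Vdual Om Gam1)
  (f_C : in_C (@Vdual_norm R d Om Gam1) T f)
  (F : Vdual Om Gam1 -> Vspace Om Gam1) (F_solver : VI_solver U B P F)
  (u : R -> Vspace Om Gam1)
  (u_P : unique_solution T U (problem_P T U B Rel P f) u)
  (u_Q : unique_solution T U (problem_Q T Rel f F) u) :
  [/\ well_posed T U (problem_P T U B Rel P f) (p_approximating T U B Rel P f) u,
      well_posed T U (problem_P T U B Rel P f) (q_approximating T Rel f F) u,
      well_posed T U (problem_Q T Rel f F) (p_approximating T U B Rel P f) u &
      well_posed T U (problem_Q T Rel f F) (q_approximating T Rel f F) u].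
Proof.
have [m m0 Bm] := B_coercive.
have [[uC uU] uP _] := u_P.
have mV0 : 0 <= m^-1 by rewrite invr_ge0 ltW.
(* [h] is not tied to [w]: for a p-approximating sequence it is the history of the curve through
   [w], for a q-approximating one [w] is [F om] while [h] is still the history of [un n]. *)
have comparison h w e t : t \in `[0, T] -> U w -> 0 <= e ->
    pairing (f t) (u t - w) <= Q_ip (B (eps w)) (eps (u t) - eps w) +
      Q_ip h (eps (u t) - eps w) + pairing (P w) (u t - w) + e * V_norm (u t - w) ->
    V_norm (w - u t) <= m^-1 * Q_norm (h - history Rel u t) + m^-1 * e.
  move=> tT Uw e0 VIw; rewrite -mulrDr ler_pdivlMl//.
  exact: VI_comparison Bm P_monotone e0 ((uP t tT).2 w Uw) VIw.
have p_cvg un : p_approximating T U B Rel P f un -> C_cvg (@V_norm R d Om Gam1) T un u.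
  move=> [unC unU [e [e0 ecvg VIn]]].
  apply: (C_cvg_history Rel_C T_gt0 mV0 unC uC (e := fun n => m^-1 * e n)).
  - by move=> n; rewrite mulr_ge0.
  - by rewrite -[X in _ --> X](mulr0 m^-1); apply: cvgM => //; exact: cvg_cst.
  - move=> n t tT; apply: comparison => //; first exact: unU.
    exact: VIn (uU t tT) tT.
have q_cvg un : q_approximating T Rel f F un -> C_cvg (@V_norm R d Om Gam1) T un u.
  move=> [unC [e [e0 ecvg Fn]]].
  apply: (C_cvg_history Rel_C T_gt0 mV0 unC uC e0 ecvg) => n t tT.
  set om := f t - eps_adj (history Rel (un n) t).
  (* [un n t] may lie outside [U] and cannot serve as a test element; [F om] lies in [U] and is
     within [e n] of it. *)
  have [UF VIF] := (F_solver om (F om)).2 erefl.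
  have VIw := VIF (u t) (uU t tT).
  have le1 : V_norm (F om - u t) <= m^-1 * Q_norm (history Rel (un n) t - history Rel u t) + m^-1 * 0.
    apply: comparison => //; move: VIw.
    rewrite /om pairingBl pairingDl mul0r addr0.
    rewrite [pairing (eps_adj _) _](_ : _ = Q_ip (history Rel (un n) t) (eps (u t - F om)))//.
    rewrite [pairing (stiffness _ _) _](_ : _ = Q_ip (B (eps (F om))) (eps (u t - F om)))//.
    by rewrite -/om -epsB; lra.
  have le2 := Fn t n tT; rewrite -/om in le2.
  apply: le_trans (seminormB_trans V_norm_seminorm (F om) _ _) _.
  rewrite mulr0 addr0 in le1.
  by rewrite [leRHS]addrC; apply: lerD le2 le1.
by split; split.
Qed.
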